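(* For every integer $m\ge 3$, the knot quandle $Q_m$ of the $m$-twist-spun trefoil is a central extension of the Schläfli quandle related to the regular tessellation $\{3,m\}$.
   Context: **Quandles.** A quandle is a non-empty set $X$ with a binary operation $\ast$ such that (Q1) $x\ast x=x$ for all $x$; (Q2) for each $x\in X$ the map $w\mapsto w\ast x$ is a bijection of $X$; (Q3) $(x\ast y)\ast z=(x\ast z)\ast(y\ast z)$ for all $x,y,z$. A homomorphism of quandles is a map preserving $\ast$; an epimorphism is a surjective homomorphism. **Knot quandle of the $m$-twist-spun trefoil.** The $m$-twist-spun trefoil is a fibered 2-knot. Let $G_m$ be the fundamental group of its fiber and $\varphi$ the automorphism of $G_m$ given by the monodromy. Explicitly, $$G_m=\langle \gamma_1,\dots,\gamma_m \mid \gamma_1=\gamma_2\gamma_m,\ \gamma_2=\gamma_3\gamma_1,\ \dots,\ \gamma_{m-1}=\gamma_m\gamma_{m-2},\ \gamma_m=\gamma_1\gamma_{m-1}\rangle$$ (that is, $\gamma_i=\gamma_{i+1}\gamma_{i-1}$ with indices modulo $m$), and $\varphi(\gamma_i)=\gamma_{i+1}$ for $1\le i\le m-1$, $\varphi(\gamma_m)=\gamma_1$. The knot quandle $Q_m$ is the set $G_m$ with the operation $x\ast y=\varphi(xy^{-1})\,y$. **Schläfli quandle related to $\{3,m\}$.** For $m\ge2$, $\{3,m\}$ (Schläfli symbol) denotes the regular tessellation by triangles with $m$ triangles around each vertex; it tessellates the 2-sphere if $2\le m\le5$, the Euclidean plane if $m=6$, and the hyperbolic plane if $m\ge7$. Let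 $V$ be its set of vertices, and for $v\in V$ let $r_v$ be the rotation of the ambient surface about $v$ by angle $2\pi/m$ (counterclockwise for a fixed orientation of the surface). Then $r_{r_w(v)}=r_w\circ r_v\circ r_w^{-1}$ for all $v,w\in V$. The Schläfli quandle related to $\{3,m\}$ is the set $\{(v,r_v)\mid v\in V\}$ with operation $(v,r_v)\ast(w,r_w)=(r_w(v),r_{r_w(v)})$. **Central extension.** Let $\widetilde X$ and $X$ be quandles. $\widetilde X$ is a central extension of $X$ if there are a non-trivial abelian group $A$ acting on the set $\widetilde X$ from the left and a quandle epimorphism $p:\widetilde X\to X$ such that: - (E0) for all $\widetilde w,\widetilde x,\widetilde y\in\widetilde X$, $p(\widetilde x)=p(\widetilde y)$ implies $\widetilde w\ast\widetilde x=\widetilde w\ast\widetilde y$; - (E1) for all $\widetilde x,\widetilde y\in\widetilde X$ and $\alpha\in A$, $(\alpha\widetilde x)\ast\widetilde y=\alpha(\widetilde x\ast\widetilde y)$ and $\widetilde x\ast(\alpha\widetilde y)=\widetilde x\ast\widetilde y$; - (E2) for each $x\in X$, $A$ acts on the fiber $p^{-1}(x)$ freely and transitively (in particular preserving it). *)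

(* Defs.v *)
From HB Require Import structures.
From mathcomp Require Import all_boot all_order all_algebra.
From mathcomp Require Import all_classical all_reals all_analysis.

Set Implicit Arguments.
Unset Strict Implicit.
Unset Printing Implicit Defensive.

Import Order.TTheory GRing.Theory Num.Theory.
Import numFieldNormedType.Exports.

Local Open Scope classical_set_scope.
Local Open Scope ring_scope.

(** * Quandles and central extensions *)

(* Quandles are carried by subsets of a type, with an ambient operation under
   which the subset is closed. *)
Record is_quandle (T : Type) (X : set T) (op : T -> T -> T) : Prop := {
  quandle_nonempty : X !=set0;
  quandle_closed : forall x y, X x -> X y -> X (op x y);
  quandle_idem : forall x, X x -> op x x = x;
  quandle_bij : forall x, X x -> set_bij X X (fun w => op w x);
  quandle_dist : forall x y z, X x -> X y -> X z ->
    op (op x y) z = op (op x z) (op y z) }.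

Record quandle_epi (T S : Type) (X : set T) (opX : T -> T -> T)
    (Y : set S) (opY : S -> S -> S) (p : T -> S) : Prop := {
  quandle_epi_fun : set_fun X Y p;
  quandle_epi_morph : forall x y, X x -> X y -> p (opX x y) = opY (p x) (p y);
  quandle_epi_surj : set_surj X Y p }.

(* The abelian group is written additively. *)
Record left_action (A : zmodType) (T : Type) (X : set T) (act : A -> T -> T) :
    Prop := {
  action_closed : forall a x, X x -> X (act a x);
  action0 : forall x, X x -> act 0 x = x;
  actionD : forall a b x, X x -> act (a + b) x = act a (act b x) }.

Record central_extension_axioms (T S : Type) (X : set T) (opX : T -> T -> T)
    (Y : set S) (opY : S -> S -> S)
    (A : zmodType) (act : A -> T -> T) (p : T -> S) : Prop := {
  cext_nontrivial : exists a : A, a != 0;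
  cext_action : left_action X act;
  cext_epi : quandle_epi X opX Y opY p;
  cext_E0 : forall w x y, X w -> X x -> X y -> p x = p y -> opX w x = opX w y;
  cext_E1l : forall a x y, X x -> X y -> opX (act a x) y = act a (opX x y);
  cext_E1r : forall a x y, X x -> X y -> opX x (act a y) = opX x y;
  cext_fiber : forall a x, X x -> p (act a x) = p x;
  cext_free : forall a x, X x -> act a x = x -> a = 0;
  cext_transitive : forall x y, X x -> X y -> p x = p y ->
    exists a, act a x = y }.

Definition central_extension (T S : Type) (X : set T) (opX : T -> T -> T)
    (Y : set S) (opY : S -> S -> S) : Prop :=
  [/\ is_quandle X opX, is_quandle Y opY &
      exists (A : zmodType) (act : A -> T -> T) (p : T -> S),
        central_extension_axioms X opX Y opY act p].

(** * Groups given by generators and relations *)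

Section Presentation.
Local Open Scope group_scope.
Variable I : choiceType.

(* The letter (i, false) stands for the generator i, (i, true) for its
   inverse; rels u v is the relation u = v. *)
Local Notation word := (seq (I * bool)).

Variable rels : word -> word -> Prop.

Definition letter_inv (l : I * bool) : I * bool := (l.1, ~~ l.2).
Definition word_inv (u : word) : word := rev (map letter_inv u).

Inductive pres_eq : word -> word -> Prop :=
| pres_eq_rel u v : rels u v -> pres_eq u v
| pres_eq_cancel l : pres_eq [:: l; letter_inv l] [::]
| pres_eq_cat u u' v v' : pres_eq u u' -> pres_eq v v' ->
    pres_eq (u ++ v) (u' ++ v')
| pres_eq_refl u : pres_eq u u
| pres_eq_sym u v : pres_eq u v -> pres_eq v u
| pres_eq_trans u v w : pres_eq u v -> pres_eq v w -> pres_eq u w.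

Definition pres_rel : rel word := fun u v => `[< pres_eq u v >].

Lemma pres_rel_refl : reflexive pres_rel.
Proof. by move=> u; apply/asboolP; exact: pres_eq_refl. Qed.

Lemma pres_rel_sym : symmetric pres_rel.
Proof. by move=> u v; apply/asboolP/asboolP; exact: pres_eq_sym. Qed.

Lemma pres_rel_trans : transitive pres_rel.
Proof.
move=> v u w /asboolP uv /asboolP vw; apply/asboolP.
exact: pres_eq_trans uv vw.
Qed.

Canonical pres_equiv := EquivRel pres_rel pres_rel_refl pres_rel_sym
  pres_rel_trans.

Local Open Scope quotient_scope.

Definition pres_group : Type := {eq_quot pres_equiv}.
HB.instance Definition _ := Choice.on pres_group.

Definition pres_class (u : word) : pres_group := \pi_{eq_quot pres_equiv} u.
Definition pres_repr (g : pres_group) : word :=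
  repr (g : {eq_quot pres_equiv}).

Lemma pres_classP u v : pres_class u = pres_class v <-> pres_eq u v.
Proof.
split=> [|uv]; first by move/eqmodP/asboolP.
by apply/eqmodP/asboolP.
Qed.

Lemma pres_reprK g : pres_class (pres_repr g) = g.
Proof. exact: reprK. Qed.

Lemma letter_invK : involutive letter_inv.
Proof. by case=> i b; rewrite /letter_inv /= negbK. Qed.

Lemma word_inv_cons l u : word_inv (l :: u) = word_inv u ++ [:: letter_inv l].
Proof. by rewrite /word_inv /= rev_cons cats1. Qed.

Lemma word_inv_cat u v : word_inv (u ++ v) = word_inv v ++ word_inv u.
Proof. by rewrite /word_inv map_cat rev_cat. Qed.

Lemma word_invK : involutive word_inv.
Proof.
by move=> u; rewrite /word_inv map_rev revK -map_comp map_id_in // => l _;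
  exact: letter_invK.
Qed.

Lemma pres_eq_mulV u : pres_eq (u ++ word_inv u) [::].
Proof.
elim: u => [|l u IHu]; first exact: pres_eq_refl.
rewrite word_inv_cons -cat1s -catA [u ++ _]catA.
apply: pres_eq_trans (pres_eq_cancel l).
rewrite -[X in pres_eq _ X]cat1s.
apply: pres_eq_cat; first exact: pres_eq_refl.
rewrite -[X in pres_eq _ X]cat0s.
by apply: pres_eq_cat; [exact: IHu | exact: pres_eq_refl].
Qed.

Lemma pres_eq_Vmul u : pres_eq (word_inv u ++ u) [::].
Proof. by rewrite -{2}[u]word_invK; exact: pres_eq_mulV. Qed.

Lemma pres_eq_inv u v : pres_eq u v -> pres_eq (word_inv u) (word_inv v).
Proof.
move=> uv; apply: (@pres_eq_trans _ ((word_inv u ++ v) ++ word_inv v)).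
  rewrite -catA -{1}[word_inv u]cats0.
  apply: pres_eq_cat; first exact: pres_eq_refl.
  exact/pres_eq_sym/pres_eq_mulV.
rewrite -[X in pres_eq _ X]cat0s.
apply: pres_eq_cat; last exact: pres_eq_refl.
apply: pres_eq_trans (pres_eq_Vmul u).
by apply: pres_eq_cat; [exact: pres_eq_refl | exact: pres_eq_sym].
Qed.

Definition pres_one : pres_group := pres_class [::].
Definition pres_mul (g h : pres_group) : pres_group :=
  pres_class (pres_repr g ++ pres_repr h).
Definition pres_inv (g : pres_group) : pres_group :=
  pres_class (word_inv (pres_repr g)).

Lemma pres_repr_class u : pres_eq (pres_repr (pres_class u)) u.
Proof. by apply/pres_classP; rewrite pres_reprK. Qed.

Lemma pres_mulE u v : pres_mul (pres_class u) (pres_class v) =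
  pres_class (u ++ v).
Proof. by apply/pres_classP; apply: pres_eq_cat; exact: pres_repr_class. Qed.

Lemma pres_invE u : pres_inv (pres_class u) = pres_class (word_inv u).
Proof. by apply/pres_classP; apply: pres_eq_inv; exact: pres_repr_class. Qed.

Lemma pres_mulA : associative pres_mul.
Proof.
move=> g h k; rewrite -[g]pres_reprK -[h]pres_reprK -[k]pres_reprK.
by rewrite !pres_mulE catA.
Qed.

Lemma pres_mul1 : left_id pres_one pres_mul.
Proof. by move=> g; rewrite -[g]pres_reprK pres_mulE. Qed.

Lemma pres_mulr1 : right_id pres_one pres_mul.
Proof. by move=> g; rewrite -[g]pres_reprK pres_mulE cats0. Qed.

Lemma pres_mulVg : left_inverse pres_one pres_inv pres_mul.
Proof.
move=> g; rewrite -[g]pres_reprK pres_invE pres_mulE.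
by apply/pres_classP; exact: pres_eq_Vmul.
Qed.

Lemma pres_mulgV : right_inverse pres_one pres_inv pres_mul.
Proof.
move=> g; rewrite -[g]pres_reprK pres_invE pres_mulE.
by apply/pres_classP; exact: pres_eq_mulV.
Qed.

HB.instance Definition _ := isGroup.Build pres_group
  pres_mulA pres_mul1 pres_mulr1 pres_mulVg pres_mulgV.

Definition pres_gen (i : I) : pres_group := pres_class [:: (i, false)].

Lemma pres_classM u v : pres_class (u ++ v) = pres_class u * pres_class v.
Proof. by rewrite -pres_mulE. Qed.

Lemma pres_classV u : pres_class (word_inv u) = (pres_class u)^-1.
Proof. by rewrite -pres_invE. Qed.

End Presentation.

(** * The knot quandle of the m-twist-spun trefoil *)

Section TwistSpunTrefoil.
Local Open Scope group_scope.
Variable m : nat.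

(* ordS and ord_pred are the successor and predecessor modulo m, so the
   generators are indexed by residues 0, ..., m - 1. *)
Inductive trefoil_rels : seq ('I_m * bool) -> seq ('I_m * bool) -> Prop :=
| TrefoilRel i :
    trefoil_rels [:: (i, false)] [:: (ordS i, false); (ord_pred i, false)].

Definition fiber_group : groupType := pres_group trefoil_rels.

Definition fiber_gen (i : 'I_m) : fiber_group := pres_gen trefoil_rels i.

Definition shift_word (u : seq ('I_m * bool)) : seq ('I_m * bool) :=
  [seq (ordS l.1, l.2) | l <- u].

Definition monodromy (g : fiber_group) : fiber_group :=
  pres_class trefoil_rels (shift_word (pres_repr g)).

Definition knot_quandle_op (x y : fiber_group) : fiber_group :=
  monodromy (x * y^-1) * y.

Lemma fiber_gen_rel i :
  fiber_gen i = fiber_gen (ordS i) * fiber_gen (ord_pred i).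
Proof.
rewrite -pres_classM; apply/pres_classP/pres_eq_rel; exact: TrefoilRel.
Qed.

Lemma shift_word_eq u v : pres_eq trefoil_rels u v ->
  pres_eq trefoil_rels (shift_word u) (shift_word v).
Proof.
elim=> {u v} [u v [i]|l|u u' v v' _ IHu _ IHv|u|u v _ IH|u v w _ IH1 _ IH2].
- rewrite /shift_word /=.
  have -> : ordS (ord_pred i) = ord_pred (ordS i) by rewrite ord_predK ordSK.
  by apply: pres_eq_rel; exact: TrefoilRel.
- exact: pres_eq_cancel.
- by rewrite /shift_word !map_cat; exact: pres_eq_cat.
- exact: pres_eq_refl.
- exact: pres_eq_sym.
- exact: pres_eq_trans IH1 IH2.
Qed.

Lemma monodromyE u : monodromy (pres_class trefoil_rels u) =
  pres_class trefoil_rels (shift_word u).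
Proof. by apply/pres_classP/shift_word_eq; exact: pres_repr_class. Qed.

Lemma monodromy_gen i : monodromy (fiber_gen i) = fiber_gen (ordS i).
Proof. exact: monodromyE. Qed.

Lemma monodromyM : {morph monodromy : g h / g * h}.
Proof.
move=> g h; rewrite -[g]pres_reprK -[h]pres_reprK -pres_classM !monodromyE.
by rewrite /shift_word map_cat pres_classM.
Qed.

End TwistSpunTrefoil.

(** * Surfaces of constant curvature, rotations and tessellations *)

Section Surface.
Variables (R : realType) (k : R).
Implicit Types (x y v : 'rV[R]_3) (F : set 'rV[R]_3).

(* For k = 1, 0, -1 the surface is the unit sphere, the Euclidean plane
   z = 1, and the upper sheet z^2 - x^2 - y^2 = 1 (the hyperboloid model of
   the hyperbolic plane). Only these values of k are used. *)
Definition surface_form x y : R :=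
  k * (x 0 0 * y 0 0 + x 0 1 * y 0 1) + x 0 2 * y 0 2.

Definition surface : set 'rV[R]_3 :=
  [set x | surface_form x x = 1 /\ (k <= 0 -> 0 < x 0 2)].

(* The squared chord between two points at geodesic distance d is
   4 sin^2(d/2), d^2, 4 sinh^2(d/2) for k = 1, 0, -1: it is an increasing
   function of d. *)
Definition chord2 x y : R :=
  (x 0 0 - y 0 0) ^+ 2 + (x 0 1 - y 0 1) ^+ 2 + k * (x 0 2 - y 0 2) ^+ 2.

(* On the tangent plane at a point v of the surface, twisted_cross v is the
   counterclockwise quarter turn; at (0, 0, 1) it sends e_0 to e_1. For k = 1
   it is the usual cross product. *)
Definition twisted_cross v x : 'rV[R]_3 :=
  \row_j nth 0 [:: v 0 1 * x 0 2 - v 0 2 * x 0 1;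
                   v 0 2 * x 0 0 - v 0 0 * x 0 2;
                   k * (v 0 0 * x 0 1 - v 0 1 * x 0 0)] j.

(* The counterclockwise rotation of the surface about its point v by the angle
   t, given by Rodrigues' formula as a linear map of the ambient space: x is
   split into its components along v and in the tangent plane at v. *)
Definition rotation (t : R) v x : 'rV[R]_3 :=
  surface_form v x *: v + cos t *: (x - surface_form v x *: v)
  + sin t *: twisted_cross v x.

(* The geodesics of the surface are its sections by planes through the origin,
   so the geodesic convex hull of F is the part of the surface in the convex
   cone spanned by F (which consists of combinations of three elements of F by
   Caratheodory's theorem). *)
Definition geodesic_hull F : set 'rV[R]_3 :=
  [set x | surface x /\ exists a b c (s t u : R),
     [/\ F a, F b & F c] /\ [/\ 0 <= s, 0 <= t & 0 <= u] /\
     x = s *: a + t *: b + u *: c].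

(* A triangle is represented by its set of vertices. *)
Definition equilateral_triangle (d : R) F : Prop :=
  exists a b c, [/\ F = [set a; b; c], F `<=` surface, free [:: a; b; c] &
    [/\ chord2 a b = d, chord2 b c = d & chord2 c a = d]].

Definition vertices (T : set (set 'rV[R]_3)) : set 'rV[R]_3 :=
  \bigcup_(F in T) F.

(* Edge-to-edge, locally finite tessellations by congruent equilateral
   triangles, m of them around each vertex. As the vertices of a triangle are
   linearly independent, tess_face_to_face says that two distinct triangles are
   disjoint or share exactly a vertex or exactly an edge. *)
Record regular_tessellation (m : nat) (T : set (set 'rV[R]_3)) : Prop := {
  tess_equilateral : exists d, forall F, T F -> equilateral_triangle d F;
  tess_cover : surface `<=` \bigcup_(F in T) geodesic_hull F;
  tess_face_to_face : forall F F', T F -> T F' ->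
    geodesic_hull F `&` geodesic_hull F' = geodesic_hull (F `&` F');
  tess_locally_finite : forall x, surface x -> exists2 U, nbhs x U &
    finite_set [set F | T F /\ geodesic_hull F `&` U !=set0];
  tess_valency : forall v, vertices T v -> ([set F | T F /\ F v] #= `I_m)%card }.

End Surface.

(** * The Schläfli quandle related to {3,m} *)

Section Schlafli.
Variables (R : realType) (m : nat).

Definition curvature : R :=
  if (m <= 5)%N then 1 else if m == 6%N then 0 else -1.

Definition is_tessellation_3m (T : set (set 'rV[R]_3)) : Prop :=
  regular_tessellation curvature m T.

Definition vertex_rotation (v : 'rV[R]_3) : 'rV[R]_3 -> 'rV[R]_3 :=
  rotation curvature (2 * pi / m%:R) v.

Definition schlafli_set (T : set (set 'rV[R]_3)) :
    set ('rV[R]_3 * ('rV[R]_3 -> 'rV[R]_3)) :=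
  [set (v, vertex_rotation v) | v in vertices T].

Definition schlafli_op (x y : 'rV[R]_3 * ('rV[R]_3 -> 'rV[R]_3)) :
    'rV[R]_3 * ('rV[R]_3 -> 'rV[R]_3) :=
  (y.2 x.1, vertex_rotation (y.2 x.1)).

End Schlafli.

(* Main.v *)
Require Import Defs.
From HB Require Import structures.
From mathcomp Require Import all_boot all_order all_algebra.
From mathcomp Require Import all_classical all_reals all_analysis.
From mathcomp Require Import ring lra zify.

(* The fiber group acts on the tessellation through the rotation subgroup of the
   (2, 3, m) triangle group: sending the generator gamma_k to
   t^(-k-3) h t^k, where t is the rotation about a vertex v and h the half-turn
   about the midpoint of an edge at v, turns the monodromy into conjugation by t,
   so that x |-> x^-1 v is a quandle homomorphism onto the vertices. Its fibers
   are the orbits of the stabilizer of v under left multiplication, and the point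
   is that this stabilizer is the cyclic group generated by
   z = gamma_(k+3) gamma_k, which is fixed by the monodromy.

   A frame is a matrix whose rows are the vertices of a face. Reflections between
   adjacent flags multiply frames on the left by three fixed matrices depending
   only on m, which generate a Coxeter group. Tits' positivity of roots shows
   that a word in these matrices fixing v is equivalent to a word in the two
   generators of the stabilizer of the vertex of a flag. Letting words act on the
   abstract flags built from the fiber group modulo z translates this into the
   claim on the stabilizer.

   The geometric input is that a face and an edge of it determine the adjacent
   face, that the m faces at a vertex close up after one turn, which forces the
   angle 2 pi / m, and that the surface is connected by geodesic segments, so
   that all faces are obtained from one of them. *)

Set Implicit Arguments.
Unset Strict Implicit.
Unset Printing Implicit Defensive.

Import Order.TTheory GRing.Theory Num.Theory.
Import numFieldNormedType.Exports.

Local Open Scope classical_set_scope.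
Local Open Scope ring_scope.

(** * Positivity of roots *)

(** That an element x of the fiber group fixes v only concerns its image in the rotation group.
    Concluding that x itself is a power of z would usually rest on the simple connectedness of the
    surface. Positivity of roots replaces this topological argument, uniformly in the three
    curvatures: it is run with words compared through their action on the flags of the fiber group,
    not through their matrices, so its conclusion can be read in the group without knowing the
    kernel of the representation.

    Words act on frames from the left, by changing the flag, while isometries act on points from the
    right; the two actions commute, so a rotation about a vertex of the frame N is right
    multiplication by N^-1 (t N).

    The group acting on the fibers must also be non-trivial. The rotations send z to t^-6, which is
    1 for m = 3 and m = 6; these values need a second representation, in which h has order 4. Hence
    representations are built from any units t, h of a ring with t^m = 1 and h t^-1 h = t h t,
    without assuming h^2 = 1. *)

Section RootPositivity.
Variables (I : eqType).
Implicit Types (u v w y : seq I) (s t i : I).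

(** The recursion is on the right end because the last letter acts first: the word ends in [t], as
    needed when it is applied to the root of [s]. *)
Fixpoint alt_word n s t : seq I :=
  if n is n'.+1 then rcons (alt_word n' t s) t else [::].

Lemma size_alt_word n s t : size (alt_word n s t) = n.
Proof. by elim: n s t => //= n IHn s t; rewrite size_rcons IHn. Qed.

Lemma alt_word_suffix n k s t : (k <= n)%N ->
  exists v, alt_word n s t = v ++ alt_word k s t.
Proof.
elim: k n s t => [|k IHk] [|n] s t //= lekn.
- by exists [::].
- by exists (rcons (alt_word n t s) t); rewrite cats0.
- have [v ->] := IHk n t s lekn; exists v.
  by rewrite rcons_cat.
Qed.

Variables (R : realFieldType) (V : lmodType R) (act : I -> {linear V -> V}).
Variables (root : I -> V) (pos : V -> Prop) (ord : I -> I -> nat).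

Definition word_act u (x : V) : V := foldr (fun i => act i) x u.

Lemma word_act_cat u v x : word_act (u ++ v) x = word_act u (word_act v x).
Proof. by rewrite /word_act foldr_cat. Qed.

Lemma word_act_lin u a b (x z : V) :
  word_act u (a *: x + b *: z) = a *: word_act u x + b *: word_act u z.
Proof. by elim: u => //= i u ->; rewrite linearD !linearZ. Qed.

(** [eqv] is any congruence that satisfies the Coxeter relations, respects the parity of the length
    and implies equality of the actions on [V]; it need not be equality in the Coxeter group. *)
Variable eqv : seq I -> seq I -> Prop.
Hypothesis eqv_refl : forall u, eqv u u.
Hypothesis eqv_sym : forall u v, eqv u v -> eqv v u.
Hypothesis eqv_trans : forall v u w, eqv u v -> eqv v w -> eqv u w.
Hypothesis eqv_cat : forall u u' v v', eqv u u' -> eqv v v' ->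
  eqv (u ++ v) (u' ++ v').
Hypothesis eqv_parity : forall u v, eqv u v -> odd (size u) = odd (size v).
Hypothesis eqv_sq : forall i, eqv [:: i; i] [::].
Hypothesis ord_gt0 : forall s t, (0 < ord s t)%N.
Hypothesis eqv_braid : forall s t, s != t ->
  eqv (alt_word (ord s t) s t) (alt_word (ord s t) t s).
Hypothesis eqv_act : forall u v, eqv u v -> word_act u =1 word_act v.
Hypothesis pos_root : forall i, pos (root i).
Hypothesis pos_comb : forall a b x z, 0 <= a -> 0 <= b -> pos x -> pos z ->
  pos (a *: x + b *: z).
Hypothesis dihedral_root : forall s t k, s != t -> (k < ord s t)%N ->
  exists a b, [/\ 0 <= a, 0 <= b &
    word_act (alt_word k s t) (root s) = a *: root s + b *: root t].

Definition reduced w := forall w', eqv w w' -> (size w <= size w')%N.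

Lemma reduced_prefix u v : reduced (u ++ v) -> reduced u.
Proof.
move=> red u' uu'; have := red (u' ++ v) (eqv_cat uu' (eqv_refl v)).
by rewrite !size_cat leq_add2r.
Qed.

Lemma reduced_suffix u v : reduced (u ++ v) -> reduced v.
Proof.
move=> red v' vv'; have := red (u ++ v') (eqv_cat (eqv_refl u) vv').
by rewrite !size_cat leq_add2l.
Qed.

Lemma reduced_eqv u v : reduced u -> eqv u v -> size u = size v -> reduced v.
Proof. by move=> red uv suv w vw; rewrite -suv; apply/red/eqv_trans/vw. Qed.

Lemma ex_reduced u : exists2 w, eqv u w & reduced w.
Proof.
pose P n := `[< exists2 w, eqv u w & size w = n >].
have exP : exists n, P n by exists (size u); apply/asboolP; exists u.
case: (ex_minnP exP) => n /asboolP[w uw sw] minn; exists w => // w' ww'.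
by rewrite sw; apply: minn; apply/asboolP; exists w' => //; exact: eqv_trans ww'.
Qed.

Lemma eqv_rcons2 u i : eqv (rcons (rcons u i) i) u.
Proof.
rewrite -!cats1 -catA -[X in eqv _ X]cats0.
by apply: eqv_cat => //; exact: eqv_sq.
Qed.

(** A word [v] equivalent to [rcons u i] and shorter than it cannot have the length of [u], by
    parity, so it is shorter than [u]; and [u] is equivalent to [u i i], hence to [v i]. *)
Lemma not_reduced_rcons u i : reduced u -> ~ reduced (rcons u i) ->
  exists2 u', (size u' < size u)%N & eqv u (rcons u' i).
Proof.
move=> redu /existsNP[v] /not_implyP[uv /negP]; rewrite -ltnNge size_rcons => ltv.
exists v.
  move: (eqv_parity uv); rewrite size_rcons /=.
  move: ltv; rewrite ltnS leq_eqVlt => /orP[/eqP->|//].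
  by case: (odd _).
apply: eqv_trans (eqv_sym (eqv_rcons2 u i)) _.
by rewrite -!cats1; apply: eqv_cat => //; rewrite cats1.
Qed.

Lemma reduced_alternating y s t : s != t -> reduced y -> all (pred2 s t) y ->
  y = alt_word (size y) s t \/ y = alt_word (size y) t s.
Proof.
elim/last_ind: y s t => [|y i IHy] s t st red; first by left.
rewrite all_rcons => /andP[ist ally].
have red' : reduced y by move: red; rewrite -cats1 => /reduced_prefix.
wlog it : s t st {ist} ally / i = t => [hw|].
  case/orP: ist => /eqP ist; last exact: hw.
  rewrite or_comm; apply: hw => //; first by rewrite eq_sym.
  by apply: sub_all ally => j /=; rewrite orbC.
subst i; left; rewrite size_rcons /=; congr rcons.
have [//||] := IHy s t _ red' ally; last by [].
case: (size y) (erefl (size y)) => [|n] sy; first by move/eqP: sy; case: (y).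
move=> ydef; exfalso; move: red; rewrite ydef /= => red.
have := red (alt_word n t s).
rewrite !size_rcons size_alt_word => red2.
by have := red2 (eqv_rcons2 _ _); rewrite ltnNge leqnSn.
Qed.

(* The deletion argument of Tits (Humphreys, Reflection Groups and Coxeter
   Groups, 5.4): among the reduced factorizations of [w] as [v ++ y] with [y] a
   word in [s] and the last letter [t] of [w], one with [v] shortest satisfies
   the induction hypothesis for both [s] and [t]. *)
Lemma reduced_root_pos w s : reduced (rcons w s) -> pos (word_act w (root s)).
Proof.
have [n] := ubnP (size w); elim: n w s => // n IHn w s.
case/lastP: w => [|w t] ltwn red; first exact: pos_root.
have redw : reduced (rcons w t).
  by move: red; rewrite -[rcons _ s]cats1 => /reduced_prefix.
have neq_st : s != t.
  apply/eqP => st; move: red; rewrite st => red.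
  have := red _ (eqv_rcons2 w t).
  by rewrite !size_rcons ltnNge leqnSn.
pose P k := `[< exists v y, [/\ eqv (rcons w t) (v ++ y),
  size v + size y = (size w).+1, all (pred2 s t) y & size v = k]%N >].
have Pw : P (size w).
  apply/asboolP; exists w, [:: t]; split=> //=; first by rewrite cats1.
    by rewrite addn1.
  by rewrite eqxx orbT.
have exP : exists k, P k by exists (size w).
case: (ex_minnP exP) => k /asboolP[v [y [wvy svy ally svk]]] minP.
have lekw : (k <= size w)%N by exact: minP.
have redvy : reduced (v ++ y).
  by apply: reduced_eqv redw wvy _; rewrite size_rcons size_cat.
have ltvn : (size v < n)%N.
  by rewrite svk; apply: leq_ltn_trans lekw _; rewrite size_rcons in ltwn.
(* Otherwise [v] would be equivalent to a shorter word followed by [i], and this [i] could be moved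
   to the front of [y], against the choice of [v]. *)
have red_min i : i \in [:: s; t] -> reduced (rcons v i).
  move=> ist; apply: contrapT => nred.
  have [v' ltv' vv'] := not_reduced_rcons (reduced_prefix redvy) nred.
  have wv' : eqv (rcons w t) (v' ++ i :: y).
    apply: eqv_trans wvy _; rewrite -cat_rcons.
    exact: eqv_cat.
  have size_v' : (size v' + (size y).+1 = (size w).+1)%N.
    have := redw _ wv'; rewrite size_rcons size_cat /= => le1.
    by apply/eqP; rewrite eqn_leq le1 andbT -svy addnS -addSn leq_add2r.
  have : P (size v').
    apply/asboolP; exists v', (i :: y); split=> //=.
    by move: ist; rewrite !inE => ->.
  by move/minP; rewrite -svk leqNgt ltv'.
have posv i : i \in [:: s; t] -> pos (word_act v (root i)).
  by move=> ist; apply: IHn => //; exact: red_min.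
have redy := reduced_suffix redvy.
(* A final [s] of [y] would cancel the last letter of [rcons w s], which is reduced. *)
have ws_red y' : eqv y (rcons y' s) -> (size y < size y')%N.
  move=> yy'; have ws : eqv (rcons (rcons w t) s) (v ++ y').
    apply: (@eqv_trans (rcons (rcons (v ++ y') s) s)); last exact: eqv_rcons2.
    rewrite -[rcons _ s]cats1 -[rcons (rcons (v ++ y') _) _]cats1.
    apply: eqv_cat => //; apply: eqv_trans wvy _.
    by rewrite rcons_cat; exact: eqv_cat.
  have := red _ ws; rewrite !size_rcons size_cat -svy.
  by rewrite -addnS leq_add2l.
have y_alt : y = alt_word (size y) s t.
  have [//|ydef] := reduced_alternating neq_st redy ally.
  case sy : (size y) => [|l]; first by move/eqP: sy; case: (y).
  rewrite sy /= in ydef; have := ws_red (alt_word l s t).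
  rewrite -ydef sy size_alt_word => /(_ (eqv_refl _)).
  by rewrite ltnNge leqnSn.
(* A longer [y] would end with one side of a braid relation, which could be replaced by the side
   ending in [s]. *)
have lty : (size y < ord s t)%N.
  rewrite ltnNge; apply/negP => leord.
  have [y1 y1def] := alt_word_suffix s t leord.
  have oy : eqv y (y1 ++ alt_word (ord s t) t s).
    by rewrite y_alt y1def; apply: eqv_cat => //; exact: eqv_braid.
  have so : size y = (size y1 + ord s t)%N.
    by rewrite y_alt y1def size_cat size_alt_word.
  have := ord_gt0 s t; case ost : (ord s t) => [|l] // _.
  rewrite ost /= -rcons_cat in oy; have := ws_red _ oy.
  by rewrite size_cat size_alt_word so ost addnS ltnNge leqnSn.
have [a [b [a0 b0 yE]]] := dihedral_root neq_st lty.
rewrite -y_alt in yE; rewrite (eqv_act wvy) word_act_cat yE word_act_lin.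
by apply: pos_comb => //; apply: posv; rewrite !inE eqxx ?orbT.
Qed.

End RootPositivity.

(** * The fiber group and its representations *)

Section FiberGroup.
Variable n : nat.
Local Notation m := n.+1.
Local Open Scope group_scope.

Local Notation G := (fiber_group m).
Local Notation gam := (@fiber_gen m).
Local Notation sh j k := (iter j (@ordS m) k).

Lemma iter_ordS_val j (k : 'I_m) : sh j k = ((k + j) %% m)%N :> nat.
Proof.
elim: j => [|j IHj] /=; first by rewrite addn0 modn_small.
by rewrite IHj -[(_ %% m).+1]addn1 modnDml addn1 addnS.
Qed.

Lemma iter_ordS_order (k : 'I_m) : sh m k = k.
Proof. by apply/ord_inj; rewrite iter_ordS_val modnDr modn_small. Qed.

Lemma iter_ordS0 (k : 'I_m) : sh k ord0 = k.
Proof. by apply/ord_inj; rewrite iter_ordS_val add0n modn_small. Qed.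

Lemma fiber_group_ind (P : G -> Prop) : P 1 ->
  (forall k x, P x -> P (gam k * x)) -> (forall k x, P x -> P ((gam k)^-1 * x)) ->
  forall x, P x.
Proof.
move=> P1 PM PV x; rewrite -[x]pres_reprK; elim: (pres_repr x) => // -[k b] u Pu.
rewrite -cat1s pres_classM; case: b; last exact: PM.
by have -> : pres_class _ [:: (k, true)] = (gam k)^-1 := pres_classV _ [:: (k, false)]; exact: PV.
Qed.

Definition fiber_center : G := gam (sh 3 ord0) * gam ord0.
Local Notation z := fiber_center.

(** The values at [k] and [k + 1] both expand to [gam (k + 4) * gam (k + 2) * gam k]. *)
Lemma fiber_centerE k : z = gam (sh 3 k) * gam k.
Proof.
rewrite -(iter_ordS0 k); elim: (nat_of_ord k) => //= j ->.
set i := iter j _ _.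
by rewrite (fiber_gen_rel (sh 3 i)) (fiber_gen_rel (sh 1 i)) /= !ordSK mulgA.
Qed.

(** Conjugation by [z] shifts the generators by 6, as does the sixth power of the monodromy; so [z]
    need not be central in the fiber group. *)
Lemma fiber_center_gen k : z * gam k = gam (sh 6 k) * z.
Proof. by rewrite {1}(fiber_centerE (sh 3 k)) (fiber_centerE k) mulgA. Qed.

Lemma fiber_center_genX j k : z ^+ j * gam k = gam (sh (6 * j) k) * z ^+ j.
Proof.
elim: j k => [|j IHj] k; first by rewrite muln0 mul1g mulg1.
rewrite expgSr -mulgA fiber_center_gen mulgA IHj -mulgA; congr (gam _ * _).
by rewrite mulnS addnC iterD.
Qed.

Lemma monodromy1 : monodromy (1 : G) = 1.
Proof. exact: monodromyE. Qed.

Lemma monodromyV (x : G) : monodromy x^-1 = (monodromy x)^-1.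
Proof. by apply/(mulgI (monodromy x)); rewrite -monodromyM !mulgV monodromy1. Qed.

Lemma monodromy_center : monodromy z = z.
Proof. by rewrite {1}/z monodromyM !monodromy_gen (fiber_centerE (sh 1 ord0)). Qed.

Lemma iter_monodromy (x : G) : iter m (@monodromy m) x = x.
Proof.
have iterE j u : iter j (@monodromy m) (pres_class _ u) =
    pres_class _ (iter j (@shift_word m) u).
  by elim: j => //= j ->; rewrite monodromyE.
rewrite -[x]pres_reprK iterE; congr (pres_class _ _).
elim: (pres_repr x) => [|[k b] u IHu].
  by have -> // : forall j, iter j (@shift_word m) [::] = [::] by elim=> //= j ->.
have -> : forall j, iter j (@shift_word m) ((k, b) :: u) =
    (sh j k, b) :: iter j (@shift_word m) u by elim=> //= j ->.
by rewrite IHu iter_ordS_order.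
Qed.

Lemma monodromy_bij : bijective (@monodromy m).
Proof.
exists (iter n (@monodromy m)) => x; last exact: iter_monodromy.
by rewrite -iterSr; exact: iter_monodromy.
Qed.

End FiberGroup.

(** * Representations of the fiber group from a turn and a half-turn *)

Section FiberRepresentation.
Variables (n : nat) (U : unitRingType) (t h : U).
Local Notation m := n.+1.
Hypotheses (t_unit : t \is a GRing.unit) (h_unit : h \is a GRing.unit).
Hypotheses (t_order : t ^+ m = 1) (braid : h * t^-1 * h = t * h * t).

Local Notation G := (fiber_group m).
Local Notation gam := (@fiber_gen m).

(** With [t ^- a] in place of [t ^- 3], the relation [gam k = gam (k + 1) * gam (k - 1)] would read:
    h times the power 2 - a of t times h equals [t * h * t]. The exponent 3 makes this the
    hypothesis [braid]. *)
Definition gen_rep (k : 'I_m) : U := t ^- k * (t ^- 3 * h) * t ^+ k.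

Definition letter_rep (l : 'I_m * bool) : U :=
  if l.2 then (gen_rep l.1)^-1 else gen_rep l.1.

Definition word_rep (u : seq ('I_m * bool)) : U := \prod_(l <- u) letter_rep l.

Definition fiber_rep (x : G) : U := word_rep (pres_repr x).

Lemma gen_rep_unit k : gen_rep k \is a GRing.unit.
Proof. by rewrite /gen_rep !unitrMl ?unitrV ?unitrX. Qed.

Lemma exp_ordS (k : 'I_m) : t ^+ ordS k = t ^+ k * t.
Proof. by rewrite /= expr_mod // exprSr. Qed.

Lemma exp_ord_pred (k : 'I_m) : t ^+ ord_pred k = t ^+ k * t^-1.
Proof. by rewrite -{2}[k]ord_predK exp_ordS mulrK. Qed.

(** This is the crossing of an edge: facing back along edge [k + 3] at the new vertex is facing edge
    [k] at the old one, followed by the half-turn. *)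
Lemma gen_rep_shift k : t ^+ iter 3 (@ordS m) k * gen_rep k = h * t ^+ k.
Proof.
have -> : iter 3 (@ordS m) k = ordS (ordS (ordS k)) by [].
rewrite !exp_ordS -!(mulrA (t ^+ k)) -[t * _ * _]mulrA -[t * (t * t)]/(t ^+ 3).
rewrite /gen_rep mulrA -exprD addnC exprD -!(mulrA (t ^+ 3)) -!(mulrA (t ^- k)).
by rewrite (mulVKr (unitrX k t_unit)) -(mulrA (t ^- 3)) mulVKr ?unitrX.
Qed.

Lemma gen_rep_ordS k :
  gen_rep (ordS k) = t ^- k * (t^-1 * (t ^- 3 * h) * t) * t ^+ k.
Proof.
have t_comm : GRing.comm (t ^+ k) t by apply/commr_sym/commrX.
have tV_comm : GRing.comm t^-1 (t ^- k).
  by apply/commr_sym/commrV/commr_sym/commrV/commrX.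
by rewrite /gen_rep exp_ordS invrM ?unitrX // tV_comm t_comm !mulrA.
Qed.

Lemma gen_rep_ord_pred k :
  gen_rep (ord_pred k) = t ^- k * (t * (t ^- 3 * h) * t^-1) * t ^+ k.
Proof.
have t_comm : GRing.comm (t ^+ k) t^-1 by apply/commr_sym/commrX/commr_sym/commrV.
have tV_comm : GRing.comm t (t ^- k) by apply/commrV/commrX.
rewrite /gen_rep exp_ord_pred invrM ?unitrV ?unitrX // invrK t_comm tV_comm.
by rewrite !mulrA.
Qed.

Lemma gen_rep_rel k : gen_rep k = gen_rep (ordS k) * gen_rep (ord_pred k).
Proof.
rewrite gen_rep_ordS gen_rep_ord_pred /gen_rep -!mulrA; congr (_ * _).
rewrite mulVKr ?unitrX // !mulrA; congr (_ * _).
have -> : t^-1 * t ^- 3 * h * t * t * t ^- 3 * h * t^-1 =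
    t^-1 * t ^- 3 * (h * t^-1 * h) * t^-1.
  have -> : t ^- 3 = t^-1 * t^-1 * t^-1.
    by rewrite -exprVn -mulrA.
  by rewrite !mulrA !mulrK.
by rewrite braid !mulrA mulrK // -exprVn -exprS [_ ^+ 4]exprSr mulrVK.
Qed.

Lemma word_rep_cat u v : word_rep (u ++ v) = word_rep u * word_rep v.
Proof. exact: big_cat. Qed.

Lemma word_rep_eq u v : pres_eq (@trefoil_rels m) u v -> word_rep u = word_rep v.
Proof.
elim=> {u v} [u v [k]|[k b]|u u' v v' _ IHu _ IHv|u|u v _ ->|u v w _ -> _ ->] //.
- by rewrite /word_rep !big_cons big_nil !mulr1; exact: gen_rep_rel.
- rewrite /word_rep !big_cons big_nil !mulr1 /letter_rep.
  by case: b => /=; rewrite ?mulVr ?divrr // gen_rep_unit.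
- by rewrite !word_rep_cat IHu IHv.
Qed.

Lemma fiber_rep_class u : fiber_rep (pres_class _ u) = word_rep u.
Proof. by apply/word_rep_eq; exact: pres_repr_class. Qed.

Lemma fiber_rep1 : fiber_rep 1%g = 1.
Proof. by rewrite fiber_rep_class /word_rep big_nil. Qed.

Lemma fiber_repM : {morph fiber_rep : x y / (x * y)%g >-> x * y}.
Proof.
move=> x y; rewrite -[x]pres_reprK -[y]pres_reprK -pres_classM.
by rewrite !fiber_rep_class word_rep_cat.
Qed.

Lemma fiber_rep_gen k : fiber_rep (gam k) = gen_rep k.
Proof. by rewrite fiber_rep_class /word_rep big_seq1. Qed.

Lemma fiber_rep_unit x : fiber_rep x \is a GRing.unit.
Proof.
apply/unitrP; exists (fiber_rep x^-1%g).
by rewrite -!fiber_repM mulVg mulgV fiber_rep1.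
Qed.

Lemma fiber_repV x : fiber_rep x^-1%g = (fiber_rep x)^-1.
Proof.
by apply: (mulrI (fiber_rep_unit x)); rewrite -fiber_repM mulgV fiber_rep1 divrr
  ?fiber_rep_unit.
Qed.

Lemma fiber_rep_monodromy x : fiber_rep (monodromy x) = t^-1 * fiber_rep x * t.
Proof.
have conjM a b : (t^-1 * a * t) * (t^-1 * b * t) = t^-1 * (a * b) * t.
  by rewrite -!mulrA mulVKr.
have rep_gen k : fiber_rep (gam (ordS k)) = t^-1 * fiber_rep (gam k) * t.
  rewrite !fiber_rep_gen /gen_rep exp_ordS invrM ?unitrX // -!mulrA.
  by [].
elim/fiber_group_ind: x => [|k x IHx|k x IHx].
- by rewrite monodromy1 fiber_rep1 mulr1 mulVr.
- by rewrite monodromyM monodromy_gen !fiber_repM IHx rep_gen conjM.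
- rewrite monodromyM monodromyV monodromy_gen !fiber_repM !fiber_repV IHx rep_gen.
  by rewrite -conjM !invrM ?unitrMl ?unitrV ?fiber_rep_unit // invrK !mulrA.
Qed.

(** The factor [h ^+ 2] is 1 for the half-turns of the tessellation, but -1 in the representation
    over the field with three elements. *)
Lemma fiber_rep_center : fiber_rep (fiber_center n) = t ^- 6 * h ^+ 2.
Proof.
rewrite fiber_repM !fiber_rep_gen.
have -> : gen_rep (iter 3 (@ordS m) ord0) = t ^- 3 * (t ^- 3 * h) * t ^+ 3.
  rewrite /gen_rep; have -> // : t ^+ iter 3 (@ordS m) ord0 = t ^+ 3.
  have -> : iter 3 (@ordS m) ord0 = ordS (ordS (ordS ord0)) by [].
  by rewrite !exp_ordS expr0 mul1r -mulrA.
rewrite /gen_rep expr0 mulr1 invr1 mul1r -mulrA mulVKr ?unitrX //.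
by rewrite !mulrA -invrM ?unitrX // -exprD -mulrA.
Qed.

End FiberRepresentation.

(** * Matrices of the triangle groups *)

Lemma ord3_ind (P : 'I_3 -> Prop) : P ord0 -> P 1 -> P ord_max -> forall i, P i.
Proof.
move=> P0 P1 P2 [[|[|[|i]]] lti] //.
- by have -> : Ordinal lti = ord0 by exact/val_inj.
- by have -> : Ordinal lti = 1 by exact/val_inj.
- by have -> : Ordinal lti = ord_max by exact/val_inj.
Qed.

Lemma sum3 (T : nmodType) (f : 'I_3 -> T) : \sum_i f i = f 0 + f 1 + f ord_max.
Proof.
rewrite !big_ord_recl big_ord0 addr0 addrA; congr (f _ + f _ + f _); exact/val_inj.
Qed.

Section ExplicitMatrices.
Variable R : comUnitRingType.

Definition mx3 (a b c d e f g h i : R) : 'M[R]_3 :=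
  \matrix_(r, s) nth 0 (nth [::] [:: [:: a; b; c]; [:: d; e; f]; [:: g; h; i]] r) s.

Lemma mx3M a b c d e f g h i a' b' c' d' e' f' g' h' i' :
  mx3 a b c d e f g h i * mx3 a' b' c' d' e' f' g' h' i' =
  mx3 (a * a' + b * d' + c * g') (a * b' + b * e' + c * h')
      (a * c' + b * f' + c * i')
      (d * a' + e * d' + f * g') (d * b' + e * e' + f * h')
      (d * c' + e * f' + f * i')
      (g * a' + h * d' + i * g') (g * b' + h * e' + i * h')
      (g * c' + h * f' + i * i').
Proof.
apply/matrixP => r s; rewrite !mxE !big_ord_recl big_ord0 !mxE /= addr0 addrA.
by case: r => [[|[|[|r]]] ?] //=; case: s => [[|[|[|s]]] ?].
Qed.

Lemma mx3_1 : 1 = mx3 1 0 0 0 1 0 0 0 1.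
Proof.
apply/matrixP => r s; rewrite !mxE.
by case: r => [[|[|[|r]]] ?] //=; case: s => [[|[|[|s]]] ?].
Qed.

Lemma mx3_row a b c a' b' c' a'' b'' c'' (M : 'M[R]_3) i :
  row i (mx3 a b c a' b' c' a'' b'' c'' * M) =
  nth 0 [:: a; a'; a''] i *: row 0 M + nth 0 [:: b; b'; b''] i *: row 1 M +
  nth 0 [:: c; c'; c''] i *: row ord_max M.
Proof.
rewrite row_mul mulmx_sum_row sum3.
by elim/ord3_ind: i; rewrite !mxE.
Qed.

End ExplicitMatrices.

Section CoxeterMatrices.
Variables (R : comUnitRingType) (lam : R).

(* The rows of [simple_mx i * M] are those of the frame adjacent to [M] across
   its [i]-th panel: they differ from the rows of [M] by the vertex, the edge or
   the face of the flag, for [i = 0, 1, 2]. *)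
Definition simple_mx (i : 'I_3) : 'M[R]_3 :=
  match val i with
  | 0 => mx3 0 1 0 1 0 0 0 0 1
  | 1 => mx3 1 0 0 0 0 1 0 1 0
  | _ => mx3 1 0 0 0 1 0 lam lam (- 1)
  end.

Local Notation s0 := (simple_mx ord0).
Local Notation s1 := (simple_mx 1).
Local Notation s2 := (simple_mx ord_max).

(** On rows a, b, c this gives a, c, lam (a + c) - b, the next face around a; [half_turn_mx] gives
    b, a, lam (a + b) - c, the other face of the edge {a, b} seen from b. *)
Definition turn_mx := mx3 1 0 0 0 0 1 lam (- 1) lam.
Definition half_turn_mx := mx3 0 1 0 1 0 0 lam lam (- 1).

Ltac mx3_ring := rewrite ?mx3M ?mx3_1; congr mx3; ring.

Lemma simple_mx_sq i : simple_mx i * simple_mx i = 1.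
Proof.
by case: i => [[|[|[|i]]] ?] //; rewrite /simple_mx /=; mx3_ring.
Qed.

Lemma simple_mx_unit i : simple_mx i \is a GRing.unit.
Proof. by apply/unitrP; exists (simple_mx i); rewrite simple_mx_sq. Qed.

Lemma turn_mxE : turn_mx = s2 * s1.
Proof. rewrite /turn_mx /simple_mx /=; mx3_ring. Qed.

Lemma half_turn_mxE : half_turn_mx = s2 * s0.
Proof. rewrite /half_turn_mx /simple_mx /=; mx3_ring. Qed.

Lemma turn_mx_unit : turn_mx \is a GRing.unit.
Proof. by rewrite turn_mxE unitrMl simple_mx_unit. Qed.

Lemma turn_mxV : turn_mx^-1 = s1 * s2.
Proof.
apply: (mulrI turn_mx_unit); rewrite divrr ?turn_mx_unit //.
by rewrite turn_mxE mulrA -(mulrA s2) simple_mx_sq mulr1 simple_mx_sq.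
Qed.

Lemma half_turn_mx_sq : half_turn_mx ^+ 2 = 1.
Proof. rewrite expr2 /half_turn_mx; mx3_ring. Qed.

Lemma half_turn_mxC : half_turn_mx = s0 * s2.
Proof. rewrite /half_turn_mx /simple_mx /=; mx3_ring. Qed.

Lemma half_turn_mx_unit : half_turn_mx \is a GRing.unit.
Proof. by rewrite half_turn_mxE unitrMl simple_mx_unit. Qed.

(** As the half-turn is an involution, this is the relation (t h)^3 = 1 of the triangle group. It
    holds for every [lam], since t h is s2 (s1 s0) s2, a conjugate of the cyclic permutation s1 s0
    of the rows. *)
Lemma turn_braid :
  half_turn_mx * turn_mx^-1 * half_turn_mx = turn_mx * half_turn_mx * turn_mx.
Proof.
rewrite turn_mxV /turn_mx /half_turn_mx /simple_mx /=; mx3_ring.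
Qed.

Lemma row_simple0 (M : 'M[R]_3) i : row i (s0 * M) = row (nth 0 [:: 1; 0; ord_max] i) M.
Proof.
by rewrite /simple_mx mx3_row; elim/ord3_ind: i; rewrite /= !(scale0r, scale1r, add0r, addr0).
Qed.

Lemma row_simple1 (M : 'M[R]_3) i : row i (s1 * M) = row (nth 0 [:: 0; ord_max; 1] i) M.
Proof.
by rewrite /simple_mx mx3_row; elim/ord3_ind: i; rewrite /= !(scale0r, scale1r, add0r, addr0).
Qed.

Lemma row_simple2 (M : 'M[R]_3) i : row i (s2 * M) =
  nth 0 [:: row 0 M; row 1 M; lam *: (row 0 M + row 1 M) - row ord_max M] i.
Proof.
rewrite /simple_mx mx3_row; elim/ord3_ind: i; rewrite /= ?scale0r ?scale1r ?add0r ?addr0 //.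
by rewrite scalerDr scaleN1r.
Qed.

Lemma row0_turn j (M : 'M[R]_3) : row 0 (turn_mx ^+ j * M) = row 0 M.
Proof.
elim: j => [|j IHj]; first by rewrite expr0 mul1r.
rewrite exprS -mulrA [LHS]mx3_row /= IHj.
by rewrite scale1r !scale0r !addr0.
Qed.

End CoxeterMatrices.

(** * The cyclic subgroup generated by [z], as an additive abelian group *)

Section CyclicZmodule.
Variables (G : groupType) (z : G).
Local Open Scope group_scope.

(** Two natural exponents encode an integer power of [z]. The predicate is boolean so that the
    subgroup is a subtype with injective [val]. *)
Definition in_cycle (x : G) : bool := `[< exists i j, z ^+ i * x = z ^+ j >].

Lemma in_cycleP x : reflect (exists i j, z ^+ i * x = z ^+ j) (in_cycle x).
Proof. exact: asboolP. Qed.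

Lemma in_cycle1 : in_cycle 1.
Proof. by apply/in_cycleP; exists 0%N, 0%N; rewrite mulg1. Qed.

Lemma in_cycleX i : in_cycle (z ^+ i).
Proof. by apply/in_cycleP; exists 0%N, i; rewrite mul1g. Qed.

Lemma in_cycle_comm x : in_cycle x -> commute z x.
Proof.
move=> /in_cycleP[i [j zx]]; have -> : x = z ^- i * z ^+ j by rewrite -zx mulKg.
by apply: commuteM; [apply: commuteV|]; apply: commuteX; exact: commute_refl.
Qed.

Lemma in_cycle_commX x i : in_cycle x -> commute x (z ^+ i).
Proof. by move=> /in_cycle_comm/commute_sym/commuteX; apply. Qed.

Lemma in_cycle_commute x y : in_cycle x -> in_cycle y -> commute x y.
Proof.
move=> cx /in_cycleP[i [j zy]]; have -> : y = z ^- i * z ^+ j by rewrite -zy mulKg.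
by apply: commuteM; [apply: commuteV|]; exact: in_cycle_commX.
Qed.

Lemma in_cycleM x y : in_cycle x -> in_cycle y -> in_cycle (x * y).
Proof.
move=> cx /in_cycleP[k [l zy]]; have /in_cycleP[i [j zx]] := cx.
apply/in_cycleP; exists (i + k)%N, (j + l)%N.
rewrite !expgnDr -!mulgA [z ^+ k * _]mulgA -(in_cycle_commX k cx).
by rewrite -!mulgA zy !mulgA zx.
Qed.

Lemma in_cycleV x : in_cycle x -> in_cycle x^-1.
Proof.
move=> cx; have /in_cycleP[i [j zx]] := cx; apply/in_cycleP; exists j, i.
by rewrite -zx -mulgA mulgV mulg1.
Qed.

Definition cycle_type := {x : G | in_cycle x}.

Definition cycle_zero : cycle_type := exist _ 1 in_cycle1.
Definition cycle_add (a b : cycle_type) : cycle_type :=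
  exist _ (val a * val b) (in_cycleM (valP a) (valP b)).
Definition cycle_opp (a : cycle_type) : cycle_type :=
  exist _ (val a)^-1 (in_cycleV (valP a)).

Lemma cycle_addA : associative cycle_add.
Proof. by move=> a b c; apply/val_inj; rewrite /= mulgA. Qed.

Lemma cycle_addC : commutative cycle_add.
Proof.
by move=> a b; apply/val_inj; exact: in_cycle_commute (valP a) (valP b).
Qed.

Lemma cycle_add0 : left_id cycle_zero cycle_add.
Proof. by move=> a; apply/val_inj; rewrite /= mul1g. Qed.

Lemma cycle_addN : left_inverse cycle_zero cycle_opp cycle_add.
Proof. by move=> a; apply/val_inj; rewrite /= mulVg. Qed.

HB.instance Definition _ := Choice.on cycle_type.
HB.instance Definition _ := GRing.isZmodule.Build cycle_type
  cycle_addA cycle_addC cycle_add0 cycle_addN.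

End CyclicZmodule.

(** * Rotations about the first vertex of a frame *)

Section Rotations.
Variables (R : realType) (al : R).
Hypotheses (al_gt0 : 0 < al) (al_ltpi : al < pi).
Let lam := 2 * cos al.

(** Modulo the first row, this rotates by [th] the plane in which rows 1 and 2 are unit vectors at
    angle [al]. The first column restores the component along the vertex: [q] is the value of the
    form at two vertices of a face, since that value g satisfies g / (1 + g) = cos al. The matrix
    interpolates the powers of [turn_mx], so that any direction at a vertex can be compared with the
    faces there. *)
Definition rot_mx (th : R) : 'M[R]_3 :=
  let c := cos al in let C := cos th in let S := sin th / sin al in
  let q := c / (1 - c) in
  mx3 1 0 0
      (q * (1 - C + c * S - S)) (C - c * S) S
      (q * (1 + S - C - c * S)) (- S) (C + c * S).

Lemma sin_al_gt0 : 0 < sin al.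
Proof. by apply: sin_gt0_pi; rewrite al_gt0. Qed.

Lemma cos_al_lt1 : cos al < 1.
Proof.
rewrite lt_neqAle cos_le1 andbT; apply/eqP => c1.
by have := cos2Dsin2 al; rewrite c1; have := sin_al_gt0; nra.
Qed.

Lemma rot_mxD a b : rot_mx (a + b) = rot_mx a * rot_mx b.
Proof.
have s_gt0 := sin_al_gt0; have c_lt1 := cos_al_lt1.
rewrite /rot_mx sinD cosD /=.
have sE : (sin al) ^+ 2 = 1 - (cos al) ^+ 2 by rewrite -(cos2Dsin2 al); ring.
set c := cos al in sE c_lt1 *; set s := sin al in sE s_gt0 *.
set C := cos a; set C' := cos b.
have aE : sin a = s * (sin a / s) by rewrite mulrC divfK // gt_eqF.
have bE : sin b = s * (sin b / s) by rewrite mulrC divfK // gt_eqF.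
have -> : (sin a * C' + C * sin b) / s = (sin a / s) * C' + C * (sin b / s) by ring.
have -> : sin a * sin b = (1 - c ^+ 2) * (sin a / s * (sin b / s)).
  by rewrite {1}aE {1}bE -sE; ring.
rewrite mx3M; set S := sin a / s; set S' := sin b / s.
by congr mx3; ring.
Qed.

Lemma rot_mx0 : rot_mx 0 = 1.
Proof. by rewrite mx3_1 /rot_mx sin0 cos0 !mul0r; congr mx3; ring. Qed.

Lemma rot_mx_turn : rot_mx al = turn_mx lam.
Proof.
have s_gt0 := sin_al_gt0; have c_lt1 := cos_al_lt1.
rewrite /turn_mx /rot_mx divff ?gt_eqF // /lam; congr mx3; try ring.
by field; rewrite subr_eq0 gt_eqF.
Qed.

Lemma turn_mxX k : turn_mx lam ^+ k = rot_mx (al *+ k).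
Proof.
elim: k => [|k IHk]; first by rewrite expr0 mulr0n rot_mx0.
by rewrite exprS mulrS rot_mxD IHk rot_mx_turn.
Qed.

Lemma rot_mx_2pi : rot_mx (2 * pi) = 1.
Proof.
rewrite -rot_mx0 /rot_mx.
have -> : 2 * pi = pi *+ 2 :> R by rewrite mulr_natl.
by rewrite sin2pi cos2pi sin0 cos0.
Qed.

End Rotations.

(** * Flags of the abstract tessellation *)

Section Flags.
Variable n : nat.
Local Notation m := n.+1.
Local Notation G := (fiber_group m).
Local Notation gam := (@fiber_gen m).
Local Notation z := (fiber_center n).
Local Notation sh j k := (iter j (@ordS m) k).

(* The flag (x, k, b) lies at the vertex <z>x, on the edge joining it to
   <z>(gam k * x) and on one of the two faces of this edge, according to b. *)
Definition flag : Type := (G * 'I_m * bool)%type.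

(** The edge leading back from [gam k * x] to [x] has index [k + 3] because [gam (k + 3) * gam k] is
    [z]. The flags [(x, k, true)] and [(x, ordS k, false)] lie on the same face. *)
Definition flag_step (i : 'I_3) (f : flag) : flag :=
  let: (x, k, b) := f in
  match val i with
  | 0 => (gam k * x, sh 3 k, ~~ b)%g
  | 1 => if b then (x, ordS k, false) else (x, ord_pred k, true)
  | _ => (x, k, ~~ b)
  end.

Definition flag_act (u : seq 'I_3) (f : flag) : flag := foldr flag_step f u.

(* Crossing an edge twice multiplies the group element by [z] and shifts the
   index of the edge by 6. *)
Definition flag_eq (f g : flag) : Prop :=
  exists i j, [/\ z ^+ i * f.1.1 = z ^+ j * g.1.1, sh (6 * i) f.1.2 = sh (6 * j) g.1.2
    & f.2 = g.2]%g.

(** This plays the role of equality in the Coxeter group. Unlike equality of matrices, it retains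
    the group element up to powers of [z]. *)
Definition word_eq (u v : seq 'I_3) := forall f, flag_eq (flag_act u f) (flag_act v f).

Lemma flag_eq_refl f : flag_eq f f.
Proof. by exists 0%N, 0%N. Qed.

Lemma flag_eq_sym f g : flag_eq f g -> flag_eq g f.
Proof. by move=> [i [j [? ? ?]]]; exists j, i. Qed.

Lemma shD i j k : sh (6 * (i + j)) k = sh (6 * i) (sh (6 * j) k).
Proof. by rewrite mulnDr iterD. Qed.

Lemma flag_eq_trans g f h : flag_eq f g -> flag_eq g h -> flag_eq f h.
Proof.
move=> [i [j [fg1 fg2 fg3]]] [k [l [gh1 gh2 gh3]]].
exists (k + i)%N, (j + l)%N; split; last by rewrite fg3.
  by rewrite !expgnDr -!mulgA fg1 -gh1 !mulgA -!expgnDr addnC.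
by rewrite !shD fg2 -gh2 -!shD addnC.
Qed.

Lemma iter_comm T (f g : T -> T) j x : (forall y, f (g y) = g (f y)) ->
  iter j f (g x) = g (iter j f x).
Proof. by move=> fg; elim: j => //= j ->. Qed.

(** Moving [z] past [gam k] turns it into [gam (k + 6)]: the shift of the edge index in [flag_eq] is
    what makes crossing an edge well defined. *)
Lemma flag_step_eq i f g : flag_eq f g -> flag_eq (flag_step i f) (flag_step i g).
Proof.
case: f g => [[x k] b] [[y l] c] [p [q /= [xy kl ->]]].
case: i => [[|[|[|i]]] ?] //=.
- exists p, q; split=> //=.
    by rewrite !mulgA !fiber_center_genX -!mulgA xy kl.
  have sh3 j k' : sh j (ordS (ordS (ordS k'))) = ordS (ordS (ordS (sh j k'))).
    by elim: j => //= j ->.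
  by rewrite !sh3 kl.
- have shS j k' : sh j (ordS k') = ordS (sh j k') by exact: iter_comm.
  have shP j k' : sh j (ord_pred k') = ord_pred (sh j k').
    by apply: iter_comm => k''; rewrite ordSK ord_predK.
  by case: c; exists p, q; split=> //=; rewrite ?shS ?shP kl.
- by exists p, q.
Qed.

Lemma flag_act_eq u f g : flag_eq f g -> flag_eq (flag_act u f) (flag_act u g).
Proof. by move=> fg; elim: u => //= i u; exact: flag_step_eq. Qed.

Lemma flag_act_cat u v f : flag_act (u ++ v) f = flag_act u (flag_act v f).
Proof. exact: foldr_cat. Qed.

Lemma word_eq_cat u u' v v' :
  word_eq u u' -> word_eq v v' -> word_eq (u ++ v) (u' ++ v').
Proof.
move=> uu' vv' f; rewrite !flag_act_cat.
by apply: (flag_eq_trans (uu' _)); exact: flag_act_eq.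
Qed.

Lemma flag_act_parity u f : (flag_act u f).2 = odd (size u) (+) f.2.
Proof.
elim: u => //= i u IHu; rewrite addNb -IHu; case: (flag_act u f) => [[x k] b] /=.
by case: i => [[|[|[|i]]] ?] //=; case: b.
Qed.

Lemma word_eq_parity u v : word_eq u v -> odd (size u) = odd (size v).
Proof.
move=> /(_ (1%g, ord0, false)) [i [j [_ _]]].
by rewrite !flag_act_parity !addbF.
Qed.

Lemma flag_step_sq i f : flag_eq (flag_step i (flag_step i f)) f.
Proof.
case: f => [[x k] b]; case: i => [[|[|[|i]]] ?] //=.
- exists 0%N, 1%N; split; rewrite //= ?negbK //.
  by rewrite expg0 expg1 mul1g (fiber_centerE k) mulgA.
- by case: b; rewrite /= ?ordSK ?ord_predK; exact: flag_eq_refl.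
- by rewrite negbK; exact: flag_eq_refl.
Qed.

(** The sum of two distinct indices among 0, 1, 2 determines the pair. *)
Definition flag_ord (s t : 'I_3) : nat :=
  match (s + t)%N with 1 => 3 | 2 => 2 | _ => m end.

Local Notation o1 := (1%R : 'I_3).
Local Notation o2 := (ord_max : 'I_3).

Lemma flag_act_alt12 j x k b :
  flag_act (alt_word j o2 o1) (x, k, b) =
    (x, iter (uphalf j) (if b then @ordS m else @ord_pred m) k, odd j (+) b) /\
  flag_act (alt_word j o1 o2) (x, k, b) =
    (x, iter (half j) (if b then @ord_pred m else @ordS m) k, odd j (+) b).
Proof.
elim: j k b => [|j IHj] k b; first by [].
rewrite /= -!cats1 !flag_act_cat /=; split.
  case: b; rewrite (IHj _ _).2 -iterSr /= ?addbF ?addbT //.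
  by rewrite negbK.
by rewrite (IHj _ _).1; case: b; rewrite /= ?addbF ?addbT ?negbK // uphalf_half.
Qed.

Lemma word_eq_sym u v : word_eq u v -> word_eq v u.
Proof. by move=> uv f; exact: flag_eq_sym. Qed.

Lemma flag_braid01 : word_eq (alt_word 3 ord0 o1) (alt_word 3 o1 ord0).
Proof.
move=> [[x k] []] /=.
  exists 0%N, 0%N; rewrite /= !ordSK; split=> //.
  by rewrite expg0 !mul1g mulgA (fiber_gen_rel (ordS k)) ordSK.
(* On this side of the edge the two words end at flags that differ by one factor [z], as
   [gam (k + 4) * gam k] is [gam (k + 4) * gam (k + 1) * gam (k - 1)]. *)
exists 1%N, 0%N; rewrite /= !ord_predK; split=> //.
rewrite expg0 expg1 mul1g (fiber_centerE (ordS k)) /= -!mulgA; congr (_ * _)%g.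
by rewrite mulgA -fiber_gen_rel.
Qed.

Lemma flag_braid02 : word_eq (alt_word 2 ord0 o2) (alt_word 2 o2 ord0).
Proof. by move=> [[x k] b] /=; exact: flag_eq_refl. Qed.

(** Two letters move the edge by one step. One word advances and the other goes back, by numbers of
    steps that add up to [m]. *)
Lemma flag_braid12 : word_eq (alt_word m o1 o2) (alt_word m o2 o1).
Proof.
have iterSP (i j : nat) k : (i + j = m)%N ->
    iter i (@ordS m) k = iter j (@ord_pred m) k.
  move=> ijm; have kE : iter (j + i) (@ordS m) k = k.
    by rewrite addnC ijm iter_ordS_order.
  rewrite -{2}kE iterD.
  by elim: {ijm kE} j => // j IHj; rewrite iterSr ordSK.
move=> [[x k] b]; rewrite (flag_act_alt12 _ _ _ _).1 (flag_act_alt12 _ _ _ _).2.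
exists 0%N, 0%N; split=> //=; have mE := uphalf_half m; have mD := odd_double_half m.
by case: b; [rewrite -(iterSP (uphalf m) (half m))|rewrite (iterSP _ (uphalf m))] => //;
  rewrite mE; lia.
Qed.

Lemma flag_braid s t : s != t ->
  word_eq (alt_word (flag_ord s t) s t) (alt_word (flag_ord s t) t s).
Proof.
elim/ord3_ind: s; elim/ord3_ind: t => // _.
- exact: flag_braid01.
- exact: flag_braid02.
- exact/word_eq_sym/flag_braid01.
- exact: flag_braid12.
- exact/word_eq_sym/flag_braid02.
- exact/word_eq_sym/flag_braid12.
Qed.

Lemma flag_reach x : exists u, flag_eq (flag_act u (1%g, ord0, true)) (x, ord0, true).
Proof.
have turn u f (k : 'I_m) y : flag_eq (flag_act u f) (y, ord0, true) ->
    exists u', flag_eq (flag_act u' f) (y, k, true).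
  rewrite -(iter_ordS0 k) => fu; elim: (nat_of_ord k) => [|j [u' fu']].
    by exists u.
  by exists (o2 :: o1 :: u'); have := flag_step_eq o2 (flag_step_eq o1 fu').
have turn0 u f (k : 'I_m) y : flag_eq (flag_act u f) (y, k, true) ->
    exists u', flag_eq (flag_act u' f) (y, ord0, true).
  rewrite -(iter_ordS0 k); elim: (nat_of_ord k) u => [|j IHj] u fu.
    by exists u.
  apply: (IHj [:: o1, o2 & u]).
  by have := flag_step_eq o1 (flag_step_eq o2 fu); rewrite /= ordSK.
elim/fiber_group_ind: x => [|k x [u ux]|k x [u ux]].
- by exists [::]; exact: flag_eq_refl.
- have [v vx] := turn _ _ k _ ux.
  apply: (turn0 [:: o2, ord0 & v] _ (sh 3 k)).
  by have := flag_step_eq o2 (flag_step_eq ord0 vx).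
(* The inverse of [gam k] is reached along edge [k + 3], since [gam (k + 3)] is [z] times that
   inverse. *)
- have [v vx] := turn _ _ (sh 3 k) _ ux.
  apply: (turn0 [:: o2, ord0 & v] _ k).
  apply: (flag_eq_trans (flag_step_eq o2 (flag_step_eq ord0 vx))).
  exists 0%N, 1%N; split=> //=.
  by rewrite mul1g (fiber_centerE k) mulgA mulgK.
Qed.

End Flags.

Lemma mul_turn_mx (R : comUnitRingType) (lam : R) M :
  turn_mx lam * M = simple_mx lam ord_max * (simple_mx lam 1 * M).
Proof. by rewrite turn_mxE mulrA. Qed.

Lemma mul_half_turn_mx (R : comUnitRingType) (lam : R) M :
  half_turn_mx lam * M = simple_mx lam ord_max * (simple_mx lam ord0 * M).
Proof. by rewrite half_turn_mxE mulrA. Qed.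

(** * Frames attached to abstract flags *)

Section FlagFrames.
Variables (R : comUnitRingType) (lam : R) (n : nat).
Local Notation m := n.+1.
Local Notation G := (fiber_group m).
Local Notation s_ := (simple_mx lam).
Local Notation t := (turn_mx lam).
Hypothesis turn_order : t ^+ m = 1.

Definition trefoil_rep : G -> 'M[R]_3 := fiber_rep t (half_turn_mx lam).

Definition word_mx (u : seq 'I_3) : 'M[R]_3 := \prod_(i <- u) s_ i.

Lemma word_mx_cons i u (M : 'M[R]_3) : word_mx (i :: u) * M = s_ i * (word_mx u * M).
Proof. by rewrite /word_mx big_cons mulrA. Qed.

Lemma word_mx_nil (M : 'M[R]_3) : word_mx [::] * M = M.
Proof. by rewrite /word_mx big_nil mul1r. Qed.

Lemma word_mx_cat (u v : seq 'I_3) : word_mx (u ++ v) = word_mx u * word_mx v.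
Proof. exact: big_cat. Qed.

Lemma turn_mx_word j : exists u, t ^+ j = word_mx u.
Proof.
elim: j => [|j [u IHu]]; first by exists [::]; rewrite /word_mx big_nil.
exists [:: ord_max, (1 : 'I_3) & u].
by rewrite exprS IHu turn_mxE /word_mx !big_cons mulrA.
Qed.

Definition flag_frame (f : flag n) : 'M[R]_3 :=
  (if f.2 then 1 else s_ ord_max) * t ^+ f.1.2 * trefoil_rep f.1.1.

Let t_unit := turn_mx_unit lam.
Let h_unit := half_turn_mx_unit lam.
Let braid := turn_braid lam.

Lemma trefoil_rep1 : trefoil_rep 1%g = 1.
Proof. exact: fiber_rep1. Qed.

Lemma trefoil_repM : {morph trefoil_rep : x y / (x * y)%g >-> x * y}.
Proof. exact: fiber_repM. Qed.

Lemma trefoil_repV x : trefoil_rep x^-1%g = (trefoil_rep x)^-1.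
Proof. exact: fiber_repV. Qed.

Lemma trefoil_rep_unit x : trefoil_rep x \is a GRing.unit.
Proof. exact: fiber_rep_unit. Qed.

Lemma trefoil_rep_monodromy x : trefoil_rep (monodromy x) = t^-1 * trefoil_rep x * t.
Proof. exact: fiber_rep_monodromy. Qed.

Lemma trefoil_rep_gen k :
  trefoil_rep (fiber_gen k) = t ^- k * (t ^- 3 * half_turn_mx lam) * t ^+ k.
Proof. exact: fiber_rep_gen. Qed.

Lemma trefoil_rep_center : trefoil_rep (fiber_center n) = t ^- 6.
Proof. by rewrite /trefoil_rep fiber_rep_center // half_turn_mx_sq mulr1. Qed.

Lemma flag_frame_step i f : flag_frame (flag_step i f) = s_ i * flag_frame f.
Proof.
have frE x k b : flag_frame (x, k, b) =
    (if b then 1 else s_ ord_max) * (t ^+ k * trefoil_rep x) by rewrite mulrA.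
have sK M j : s_ j * (s_ j * M) = M by rewrite mulrA simple_mx_sq mul1r.
case: f => [[x k] b]; elim/ord3_ind: i.
- rewrite -[flag_step _ _]/((fiber_gen k * x)%g, ordS (ordS (ordS k)), ~~ b).
  rewrite !frE trefoil_repM.
  have tE : t ^+ ordS (ordS (ordS k)) * trefoil_rep (fiber_gen k) =
      half_turn_mx lam * t ^+ k.
    by rewrite [trefoil_rep _]fiber_rep_gen //; exact: gen_rep_shift.
  rewrite (mulrA (t ^+ ordS _)) tE -(mulrA (half_turn_mx lam)).
  case: b; rewrite ?mul1r; first by rewrite mul_half_turn_mx sK.
  by rewrite half_turn_mxC -mulrA.
- case: b.
    rewrite -[flag_step _ _]/(x, ordS k, false) !frE exp_ordS //.
    by rewrite -exprSr exprS mul1r -(mulrA t) mul_turn_mx sK.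
  rewrite -[flag_step _ _]/(x, ord_pred k, true) !frE exp_ord_pred // mul1r.
  have -> : t ^+ k * t^-1 = t^-1 * t ^+ k.
    by apply/commr_sym/commrX/commr_sym/commrV.
  by rewrite turn_mxV -!(mulrA (s_ 1)) -(mulrA (s_ ord_max)).
- rewrite -[flag_step _ _]/(x, k, ~~ b) !frE.
  by case: b; rewrite mul1r ?sK.
Qed.

Lemma flag_frame_act u f : flag_frame (flag_act u f) = word_mx u * flag_frame f.
Proof.
rewrite /word_mx; elim: u => [|i u IHu]; first by rewrite big_nil mul1r.
by rewrite big_cons -mulrA -IHu -flag_frame_step.
Qed.

(** The center is represented by [t ^- 6], which cancels the shift by 6 of the edge index. *)
Lemma flag_frame_eq f g : flag_eq f g -> flag_frame f = flag_frame g.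
Proof.
have frameE i f' : flag_frame f' = flag_frame
    ((fiber_center n ^+ i * f'.1.1)%g, iter (6 * i) (@ordS m) f'.1.2, f'.2).
  rewrite /flag_frame /= trefoil_repM.
  have -> : trefoil_rep (fiber_center n ^+ i)%g = t ^- (6 * i).
    elim: i => [|i IHi]; first by rewrite trefoil_rep1 expr0 invr1.
    rewrite expgS trefoil_repM trefoil_rep_center IHi.
    by rewrite -invrM ?unitrX // -exprD mulnS addnC.
  rewrite iter_ordS_val expr_mod // exprD -!mulrA.
  by rewrite mulVKr ?unitrX.
case: f g => [[x k] b] [[y l] c] [i [j [/= xy kl bc]]].
by rewrite (frameE i) (frameE j (y, l, c)) /= xy kl bc.
Qed.

Lemma flag_frame_base : flag_frame (1%g, ord0, true) = 1.
Proof. by rewrite /flag_frame /= trefoil_rep1 expr0 !mulr1. Qed.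

Lemma word_mxE u : word_mx u = flag_frame (flag_act u (1%g, ord0, true)).
Proof. by rewrite flag_frame_act flag_frame_base mulr1. Qed.

Lemma word_mx_eq u v : word_eq n u v -> word_mx u = word_mx v.
Proof. by move=> uv; rewrite !word_mxE; exact/flag_frame_eq/uv. Qed.

Lemma word_mx_reach x : exists2 u, word_mx u = trefoil_rep x &
  flag_eq (flag_act u (1%g, ord0, true)) (x, ord0, true).
Proof.
have [u ux] := flag_reach x; exists u => //.
by rewrite word_mxE (flag_frame_eq ux) /flag_frame /= expr0 !mul1r.
Qed.

(** [t] and the reflection 2 preserve row 0, so only the group element of the flag determines the
    vertex. *)
Lemma row0_word_mx u (f := flag_act u (1%g, ord0, true)) :
  row 0 (word_mx u) = row 0 (trefoil_rep f.1.1).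
Proof.
rewrite word_mxE -/f /flag_frame.
have row_s2 : row 0 (s_ ord_max) = row 0 1.
  by apply/rowP => j; rewrite !mxE; elim/ord3_ind: j.
have row_t : row 0 t = row 0 1.
  by apply/rowP => j; rewrite !mxE; elim/ord3_ind: j.
have rowM (A B : 'M[R]_3) : row 0 A = row 0 1 -> row 0 (A * B) = row 0 B.
  by move=> A1; rewrite row_mul A1 -row_mul mul1mx.
rewrite -mulrA rowM; last by case: ifP.
by rewrite rowM //; elim: (nat_of_ord _) => // k IHk; rewrite exprS rowM.
Qed.

End FlagFrames.

(** * The stabilizer of a vertex *)

Lemma alt_word_cons (I : eqType) k (s t : I) :
  alt_word k.+1 s t = (if odd k then s else t) :: alt_word k s t.
Proof.
elim: k s t => [|k IHk] s t //.
by rewrite [LHS]/= -/(alt_word k.+1 t s) IHk rcons_cons /= if_neg.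
Qed.

Section VertexStabilizer.
Variables (R : realType) (n : nat).
Local Notation m := n.+1.
Hypothesis m_ge3 : (3 <= m)%N.
Let al : R := 2 * pi / m%:R.
Let lam : R := 2 * cos al.
Local Notation s_ := (simple_mx lam).

Lemma central_angle_bounds : 0 < al < pi.
Proof.
have pi0 := pi_gt0 R; rewrite /al divr_gt0 ?mulr_gt0 ?ltr0n //=.
rewrite ltr_pdivrMr ?ltr0n // mulrC ltr_pM2l //.
by rewrite (ltr_nat R 2).
Qed.

Lemma turn_mx_order : turn_mx lam ^+ m = 1.
Proof.
have /andP[al0 alpi] := central_angle_bounds.
rewrite turn_mxX // -(rot_mx_2pi al); congr rot_mx.
by rewrite -(mulr_natr al) divfK // pnatr_eq0.
Qed.

Definition cv3 (a b c : R) : 'cV[R]_3 := \col_i nth 0 [:: a; b; c] i.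

Lemma mx3_mul_cv3 a b c d e f g h i x y z :
  mx3 a b c d e f g h i *m cv3 x y z =
  cv3 (a * x + b * y + c * z) (d * x + e * y + f * z) (g * x + h * y + i * z).
Proof.
apply/colP => r; rewrite !mxE !big_ord_recl big_ord0 !mxE /= addr0 addrA.
by elim/ord3_ind: r.
Qed.

Lemma cv3_comb a b x y z x' y' z' :
  a *: cv3 x y z + b *: cv3 x' y' z' =
  cv3 (a * x + b * x') (a * y + b * y') (a * z + b * z').
Proof. by apply/colP => r; rewrite !mxE; elim/ord3_ind: r. Qed.

(* In the basis formed by the rows of a frame, the chamber of its flag is
   spanned by the vertex (1, 0, 0), the midpoint (1, 1, 0) of the edge and the
   center (1, 1, 1) of the face. The simple roots are dual to these vectors. *)
Definition simple_root (i : 'I_3) : 'cV[R]_3 :=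
  match val i with
  | 0 => cv3 1 (- 1) 0
  | 1 => cv3 0 1 (- 1)
  | _ => cv3 0 0 1
  end.

(** These partial sums are the coefficients of [v] on the simple roots. *)
Definition pos_root (v : 'cV[R]_3) : Prop :=
  [/\ 0 <= v 0 0, 0 <= v 0 0 + v 1 0 & 0 <= v 0 0 + v 1 0 + v ord_max 0].

(** [th] is half the central angle, the angle between the mirrors of reflections 1 and 2. The [sg k]
    are Chebyshev values in [mu], non-negative up to [k = m]. *)
Let th : R := pi / m%:R.
Let mu : R := 2 * cos th.
Let sg k : R := sin (th *+ k) / sin th.

Lemma th_bounds : 0 < th /\ th < pi / 2.
Proof.
have pi0 := pi_gt0 R; split; first by rewrite divr_gt0 ?ltr0n.
by rewrite /th ltr_pM2l // ltf_pV2 ?posrE ?ltr0n // (ltr_nat R 2).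
Qed.

Lemma mu_gt0 : 0 < mu.
Proof.
have [th0 thpi] := th_bounds; rewrite mulr_gt0 // cos_gt0_pihalf // thpi andbT.
by rewrite (lt_trans _ th0) // oppr_lt0 divr_gt0 ?pi_gt0.
Qed.

Lemma sin_th_gt0 : 0 < sin th.
Proof.
have [th0 thpi] := th_bounds; apply: sin_gt0_pi; rewrite th0 (lt_trans thpi) //.
by rewrite ltr_pdivrMr // ltr_pMr ?pi_gt0 // (ltr_nat R 1).
Qed.

Lemma lamE : lam = mu ^+ 2 - 2.
Proof.
rewrite /lam /mu; have -> : al = th + th by rewrite /al /th -mulrDl -mulr2n mulr_natl.
by rewrite cosD -!expr2 -[sin th ^+ 2](addKr (cos th ^+ 2)) cos2Dsin2; ring.
Qed.

Lemma sg_ge0 k : (k <= m)%N -> 0 <= sg k.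
Proof.
move=> lekm; rewrite divr_ge0 ?(ltW sin_th_gt0) //; apply: sin_ge0_pi.
have [th0 _] := th_bounds; rewrite mulrn_wge0 ?(ltW th0) //=.
have -> : pi = th *+ m by rewrite -mulr_natr divfK // pnatr_eq0.
by rewrite ler_pMn2l.
Qed.

Lemma sgSS k : sg k.+2 = mu * sg k.+1 - sg k.
Proof.
have s0 := gt_eqF sin_th_gt0; rewrite /sg !mulrS /mu.
have -> : sin (th + (th + th *+ k)) = 2 * cos th * sin (th + th *+ k) - sin (th *+ k).
  have {3}-> : th *+ k = th + th *+ k - th by ring.
  by rewrite sinD sinB; ring.
by field; rewrite s0.
Qed.

Lemma sg0 : sg 0 = 0.
Proof. by rewrite /sg mulr0n sin0 mul0r. Qed.

Lemma sg1 : sg 1 = 1.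
Proof. by rewrite /sg mulr1n divff // gt_eqF // sin_th_gt0. Qed.

Ltac root_calc := rewrite /simple_root /= ?cv3_comb /simple_mx /= ?mx3_mul_cv3;
  congr cv3; ring.

Definition simple_act (i : 'I_3) : {linear 'cV[R]_3 -> 'cV[R]_3} := mulmx (s_ i).

Lemma simple_act_word u v : word_act simple_act u v = word_mx lam u *m v.
Proof.
rewrite /word_mx; elim: u => [|i u IHu] /=; first by rewrite big_nil mul1mx.
by rewrite IHu big_cons mulmxA.
Qed.

(** Reflection 1 adds root 1 to root 2, while reflection 2 adds [mu ^+ 2] times root 2 to root 1.
    This asymmetry explains the factors [mu] and [1 / mu] in the next two lemmas. *)
Let comb (i j : 'I_3) (a b : R) := a *: simple_root i + b *: simple_root j.

Lemma dihedral12 k : word_act simple_act (alt_word k 1 ord_max) (simple_root 1) =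
  if odd k then comb 1 ord_max (sg k) (mu * sg k.+1)
  else comb 1 ord_max (sg k.+1) (mu * sg k).
Proof.
elim: k => [|k IHk].
  by rewrite /comb /= sg1 sg0 mulr0 scale1r scale0r addr0.
rewrite alt_word_cons /= IHk; case: (odd k) => /=;
  rewrite /comb /simple_root /= !cv3_comb /simple_act /= /simple_mx /= mx3_mul_cv3 ?sgSS ?lamE.
  by congr cv3; ring.
by congr cv3; ring.
Qed.

Lemma dihedral21 k : word_act simple_act (alt_word k ord_max 1) (simple_root ord_max) =
  if odd k then comb 1 ord_max (sg k.+1 / mu) (sg k)
  else comb 1 ord_max (sg k / mu) (sg k.+1).
Proof.
have mu0 := mu_gt0.
elim: k => [|k IHk].
  by rewrite /comb /= sg1 sg0 mul0r scale1r scale0r add0r.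
rewrite alt_word_cons /= IHk; case: (odd k) => /=;
  rewrite /comb /simple_root /= !cv3_comb /simple_act /= /simple_mx /= mx3_mul_cv3 ?sgSS ?lamE.
  by congr cv3; field; rewrite gt_eqF.
by congr cv3; field; rewrite gt_eqF.
Qed.

Lemma dihedral_root_pos s t k : s != t -> (k < flag_ord n s t)%N ->
  exists a b, [/\ 0 <= a, 0 <= b & word_act simple_act (alt_word k s t) (simple_root s) =
    a *: simple_root s + b *: simple_root t].
Proof.
have mu0 := mu_gt0.
elim/ord3_ind: s; elim/ord3_ind: t => // _.
- case: k => [|[|[|k]]] //= _; [exists 1, 0|exists 1, 1|exists 0, 1]; split=> //=; root_calc.
- by case: k => [|[|k]] //= _; exists 1, 0; split=> //=; root_calc.
- case: k => [|[|[|k]]] //= _; [exists 1, 0|exists 1, 1|exists 0, 1]; split=> //=; root_calc.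
- move=> ltkm; rewrite dihedral12; case: ifP => _;
    [exists (sg k), (mu * sg k.+1)|exists (sg k.+1), (mu * sg k)].
    by split=> //; rewrite ?sg_ge0 ?(ltnW ltkm) // mulr_ge0 ?sg_ge0 ?(ltW mu0) ?(ltnW ltkm).
  by split=> //; rewrite ?sg_ge0 ?(ltnW ltkm) // mulr_ge0 ?sg_ge0 ?(ltW mu0) ?(ltnW ltkm).
- by case: k => [|[|k]] //= _; exists 1, 0; split=> //=; root_calc.
- move=> ltkm; rewrite dihedral21; case: ifP => _;
    [exists (sg k), (sg k.+1 / mu)|exists (sg k.+1), (sg k / mu)];
    (split; [|apply: divr_ge0; last exact: ltW|by rewrite /comb addrC]);
    apply: sg_ge0 => //; exact: ltnW.
Qed.

Lemma reduced_root_ge0 w s : reduced (word_eq n) (rcons w s) ->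
  pos_root (word_mx lam w *m simple_root s).
Proof.
rewrite -simple_act_word.
apply: (reduced_root_pos (ord := flag_ord n)) => //.
- by move=> u f; exact: flag_eq_refl.
- by move=> u v; exact: word_eq_sym.
- by move=> v u w' uv vw f; exact: flag_eq_trans (uv f) (vw f).
- exact: word_eq_cat.
- exact: word_eq_parity.
- by move=> i f; exact: flag_step_sq.
- by move=> i j; rewrite /flag_ord; case: (i + j)%N => [|[|[]]].
- exact: flag_braid.
- by move=> u v uv x; rewrite !simple_act_word (word_mx_eq turn_mx_order uv).
- by elim/ord3_ind; split; rewrite !mxE /=; lra.
- by move=> a b x y a0 b0 [x1 x2 x3] [y1 y2 y3]; split; rewrite !mxE /=; nra.
- exact: dihedral_root_pos.
Qed.

Lemma simple_act_root s : s_ s *m simple_root s = - simple_root s.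
Proof.
rewrite -scaleN1r -[RHS]addr0 -[X in _ + X](scale0r (simple_root s)).
by elim/ord3_ind: s; root_calc.
Qed.

(** A reduced word is peeled from its right end. If its last letter were 0, the rest of the word
    would send root 0 to a vector whose coordinate 0 is -1, because the whole word preserves row 0;
    this contradicts positivity. Letters 1 and 2 preserve row 0, so the shorter word does too. *)
Lemma vertex_stabilizer u : row 0 (word_mx lam u) = row 0 1 ->
  exists2 v, word_eq n u v & all (predC1 ord0) v.
Proof.
have eq_tr v u' w : word_eq n u' v -> word_eq n v w -> word_eq n u' w.
  by move=> uv vw f; exact: flag_eq_trans (uv f) (vw f).
have [] := ex_reduced (eqv := word_eq n) _ _ u; [by move=> ? ?; exact: flag_eq_refl|exact: eq_tr|].
move=> w uw redw; rewrite (word_mx_eq turn_mx_order uw) => row_w; exists w => {uw}//.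
elim/last_ind: w redw row_w => // w s IHw redw row_w.
have posw := reduced_root_ge0 redw.
have wE : word_mx lam (rcons w s) = word_mx lam w * s_ s.
  by rewrite /word_mx -cats1 big_cat big_seq1.
have neq_s0 : s != ord0.
  apply/eqP => s0; case: posw => + _ _; rewrite -[simple_root s]opprK -simple_act_root.
  rewrite mulmxN mulmxA -[_ *m s_ s]wE.
  have -> : (- (word_mx lam (rcons w s) *m simple_root s)) 0 0 =
     - (row 0 (word_mx lam (rcons w s)) *m simple_root s) 0 0.
    by rewrite -row_mul !mxE.
  rewrite row_w -row_mul mul1mx s0 !mxE /=; lra.
rewrite all_rcons /= neq_s0; apply: IHw.
  move: redw; rewrite -cats1; apply: reduced_prefix.
  - by move=> ? ?; exact: flag_eq_refl.
  - exact: word_eq_cat.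
have -> : word_mx lam w = word_mx lam (rcons w s) * s_ s.
  by rewrite wE -mulrA simple_mx_sq mulr1.
rewrite row_mul row_w -row_mul mul1mx.
by elim/ord3_ind: s neq_s0 {redw row_w posw wE} => // _; apply/rowP => j; rewrite !mxE;
  elim/ord3_ind: j.
Qed.

(** Steps 1 and 2 leave the group element of a flag unchanged, so from the base flag they reach only
    the element 1, which must agree with [x] up to powers of [z]. *)
Lemma trefoil_rep_vertex (x : fiber_group m) : row 0 (trefoil_rep lam x) = row 0 1 ->
  in_cycle (fiber_center n) x.
Proof.
have [u <- ux] := word_mx_reach turn_mx_order x.
move=> /vertex_stabilizer[v uv v12].
have : flag_eq (flag_act v (1%g, ord0, true)) (x, ord0, true).
  exact: flag_eq_trans (flag_eq_sym (uv _)) ux.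
have v1 : (flag_act v (1%g : fiber_group m, ord0, true)).1.1 = 1%g.
  elim: v v12 {uv} => //= s v IHv /andP[s12 /IHv].
  by case: (flag_act v _) => [[y k] b] /= ->; elim/ord3_ind: s s12 => // _; case: b.
move=> [i [j [xE _ _]]]; apply/in_cycleP; exists j, i.
by rewrite -xE v1 mulg1.
Qed.

End VertexStabilizer.

(** * The central element *)

Lemma cos_lt1 (R : realType) (x : R) : 0 < x < 2 * pi -> cos x < 1.
Proof.
move=> /andP[x0 x2pi]; have -> : x = x / 2 + x / 2 by lra.
have : 0 < sin (x / 2) by apply: sin_gt0_pi; lra.
by rewrite cosD; have := cos2Dsin2 (x / 2); nra.
Qed.

(* The image of the center in SL_2(F_3) is {1, -1}. *)
Lemma fiber_center_neq1_dvd3 n : (3 %| n.+1)%N -> fiber_center n != 1%g.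
Proof.
move=> m3; pose mx2 (a b c d : 'F_3) : 'M['F_3]_2 :=
  \matrix_(r < 2, s < 2) nth 0 (nth [::] [:: [:: a; b]; [:: c; d]] r) s.
have mx2M a b c d a' b' c' d' : mx2 a b c d * mx2 a' b' c' d' =
    mx2 (a * a' + b * c') (a * b' + b * d') (c * a' + d * c') (c * b' + d * d').
  apply/matrixP => r s; rewrite !mxE !big_ord_recl big_ord0 !mxE /= addr0.
  by case: r => [[|[|r]] ?] //=; case: s => [[|[|s]] ?].
have mx21 : 1 = mx2 1 0 0 1.
  apply/matrixP => r s; rewrite !mxE.
  by case: r => [[|[|r]] ?] //=; case: s => [[|[|s]] ?].
pose t := mx2 1 1 0 1; pose t' := mx2 1 (-1) 0 1; pose h := mx2 0 1 (-1) 0.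
pose h' := mx2 0 (-1) 1 0.
have mx2_eq a b c d a' b' c' d' : a = a' -> b = b' -> c = c' -> d = d' ->
  mx2 a b c d = mx2 a' b' c' d' by move=> -> -> -> ->.
have tt' : t * t' = 1 by rewrite mx2M mx21; apply: mx2_eq; apply/eqP.
have t't : t' * t = 1 by rewrite mx2M mx21; apply: mx2_eq; apply/eqP.
have hh' : h * h' = 1 by rewrite mx2M mx21; apply: mx2_eq; apply/eqP.
have h'h : h' * h = 1 by rewrite mx2M mx21; apply: mx2_eq; apply/eqP.
have t3 : t ^+ 3 = 1.
  by rewrite -[t ^+ 3]/(t * (t * t)) !mx2M mx21; apply: mx2_eq; apply/eqP.
have t_unit : t \is a GRing.unit by apply/unitrP; exists t'.
have h_unit : h \is a GRing.unit by apply/unitrP; exists h'.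
have tV : t^-1 = t' by apply: (mulrI t_unit); rewrite divrr.
have tm : t ^+ n.+1 = 1.
  by case/dvdnP: m3 => q ->; rewrite mulnC exprM t3 expr1n.
have braid : h * t^-1 * h = t * h * t.
  by rewrite tV !mx2M; apply: mx2_eq; apply/eqP.
apply/eqP => z1; have := fiber_rep_center t_unit h_unit tm braid.
rewrite z1 fiber_rep1 // (exprM t 3 2) t3 expr1n invr1 mul1r expr2 mx2M mx21.
by move=> /matrixP/(_ 0 0); rewrite !mxE /= => /eqP.
Qed.

Lemma turn_mx_exp_neq1 (R : realType) n (al := 2 * pi / n.+1%:R : R) j :
  (3 <= n.+1)%N -> (0 < j < n.+1)%N -> turn_mx (2 * cos al) ^+ j != 1.
Proof.
move=> m_ge3 /andP[j0 jm]; have /andP[al0 alpi] := central_angle_bounds R m_ge3.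
rewrite turn_mxX //; apply/eqP => /matrixP rot1.
have := rot1 1 1; have := rot1 1 ord_max; rewrite !mxE /= => -> /eqP.
rewrite mulr0 subr0; apply/negP; rewrite lt_eqF // cos_lt1 //.
rewrite mulrn_wgt0 // -(mulr_natr al) /al mulrAC ltr_pdivrMr ?ltr0n //.
have pi2 : 0 < 2 * pi :> R by rewrite mulr_gt0 ?pi_gt0.
by rewrite (ltr_pM2l pi2) ltr_nat j0.
Qed.

(* The rotations of order [m] detect the center unless [m] divides 6. *)
Lemma fiber_center_neq1 (R : realType) n : (3 <= n.+1)%N -> fiber_center n != 1%g.
Proof.
move=> m_ge3; have [m6|Nm6] := boolP (n.+1 %| 6)%N.
  apply: fiber_center_neq1_dvd3; have := dvdn_leq (isT : (0 < 6)%N) m6.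
  by case: n m_ge3 m6 => [|[|[|[|[|[|]]]]]].
have jm : (0 < 6 %% n.+1 < n.+1)%N by rewrite lt0n ltn_pmod // andbT.
apply/eqP => z1; have /eqP := turn_mx_exp_neq1 R m_ge3 jm; apply.
have torder := turn_mx_order R m_ge3.
rewrite (expr_mod _ torder) -[LHS]invrK -(trefoil_rep_center torder) z1.
by rewrite trefoil_rep1 // invr1.
Qed.

(** * The surface and its tangent rotations *)

Lemma near_finite (T : topologicalType) (p : T) (I : Type)
    (A : set I) (P : I -> T -> Prop) : finite_set A ->
  (forall i, A i -> \forall x \near p, P i x) ->
  \forall x \near p, forall i, A i -> P i x.
Proof.
move=> finA; have [s ->] := (finite_seqP (A : set {classic I})).1 finA.
elim: s => [_|i s IHs PA]; first by apply: nearW => x i; rewrite /= in_nil.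
have Pi : \forall x \near p, P i x by apply: PA; rewrite /= mem_head.
have Ps : \forall x \near p, forall j, j \in s -> P j x.
  by apply: IHs => j js; apply: PA; rewrite /= inE js orbT.
near=> x => j; rewrite /= inE => /orP[/eqP->|js]; first by near: x.
by move: j js; near: x.
Unshelve. all: by end_near. Qed.

Section SurfaceForm.
Variables (R : realType) (k : R).
Local Notation V := 'rV[R]_3.
Local Notation B := (surface_form k).
Implicit Types (x y v : V) (r : R).

Lemma surface_formC x y : B x y = B y x.
Proof. by rewrite /surface_form; ring. Qed.

Lemma surface_formDl x y v : B (x + y) v = B x v + B y v.
Proof. by rewrite /surface_form !mxE; ring. Qed.

Lemma surface_formDr x y v : B v (x + y) = B v x + B v y.
Proof. by rewrite /surface_form !mxE; ring. Qed.

Lemma surface_formZl r x v : B (r *: x) v = r * B x v.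
Proof. by rewrite /surface_form !mxE; ring. Qed.

Lemma surface_formZr r x v : B v (r *: x) = r * B v x.
Proof. by rewrite /surface_form !mxE; ring. Qed.

Lemma surface_formNl x v : B (- x) v = - B x v.
Proof. by rewrite -scaleN1r surface_formZl mulN1r. Qed.

Lemma surface_formNr x v : B v (- x) = - B v x.
Proof. by rewrite -scaleN1r surface_formZr mulN1r. Qed.

Definition surface_formE := (surface_formDl, surface_formDr, surface_formZl,
  surface_formZr, surface_formNl, surface_formNr).

(** These are the vectors that project radially onto the surface: nonzero vectors, the upper
    half-space or the future light cone for k = 1, 0, -1. In this cone, geodesics become straight
    segments. *)
Definition open_cone : set V := [set x | 0 < B x x /\ (k <= 0 -> 0 < x 0 2)].

Lemma surface_open_cone x : surface k x -> open_cone x.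
Proof. by case=> Bx x2; rewrite /open_cone /= Bx. Qed.

Lemma open_coneZ r x : 0 < r -> open_cone x -> open_cone (r *: x).
Proof.
move=> r0 [Bx x2]; split; last by move=> k0; rewrite !mxE mulr_gt0 // x2.
by rewrite !surface_formE mulrA !mulr_gt0.
Qed.

Definition normalize x : V := (Num.sqrt (B x x))^-1 *: x.

Lemma normalize_surface x : open_cone x -> surface k (normalize x).
Proof.
move=> [Bx x2]; have s0 : 0 < Num.sqrt (B x x) by rewrite sqrtr_gt0.
split; last by move=> k0; rewrite !mxE mulr_gt0 ?invr_gt0 // x2.
rewrite /normalize !surface_formE -[X in _ * (_ * X)](sqr_sqrtr (ltW Bx)).
by field; rewrite gt_eqF.
Qed.

Definition hull_cone (F : set V) : set V := [set x |
  exists a b c (s t u : R), [/\ F a, F b & F c] /\ [/\ 0 <= s, 0 <= t & 0 <= u] /\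
  x = s *: a + t *: b + u *: c].

Lemma geodesic_hullE F x : geodesic_hull k F x <-> surface k x /\ hull_cone F x.
Proof. by []. Qed.

Lemma hull_coneZ F r x : 0 <= r -> hull_cone F x -> hull_cone F (r *: x).
Proof.
move=> r0 [a [b [c [s [t [u [Fabc [[s0 t0 u0] ->]]]]]]]].
exists a, b, c, (r * s), (r * t), (r * u); split=> //; split.
  by split; exact: mulr_ge0.
by rewrite !scalerDr !scalerA.
Qed.

Lemma hull_cone_normalize F x : open_cone x ->
  hull_cone F (normalize x) <-> hull_cone F x.
Proof.
move=> [Bx _]; have s0 : 0 < Num.sqrt (B x x) by rewrite sqrtr_gt0.
split; last by apply: hull_coneZ; rewrite invr_ge0 ltW.
move=> /(hull_coneZ (ltW s0)); rewrite /normalize scalerA divff ?gt_eqF //.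
by rewrite scale1r.
Qed.

Lemma line_cvg x y : x + s *: y @[s --> (0 : R)] --> x.
Proof.
rewrite -{2}[x]addr0 -(scale0r y).
by apply: cvgD; [exact: cvg_cst|apply: cvgZr_tmp; exact: cvg_id].
Qed.

Lemma surface_form_line_cvg x y :
  B (x + s *: y) (x + s *: y) @[s --> (0 : R)] --> B x x.
Proof.
have -> : (fun s => B (x + s *: y) (x + s *: y)) =
    (fun s : R => B x x + s * (2 * B x y) + s * (s * B y y)).
  by apply/funext => s; rewrite !surface_formE (surface_formC y x); ring.
have id0 : s @[s --> (0 : R)] --> (0 : R) by exact: cvg_id.
have := cvgD (cvgD (cvg_cst (B x x)) (cvgM id0 (cvg_cst (2 * B x y))))
  (cvgM id0 (cvgM id0 (cvg_cst (B y y)))).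
by rewrite !mul0r !addr0; apply.
Qed.

Lemma near_open_cone x y : open_cone x ->
  \forall s \near (0 : R), open_cone (x + s *: y).
Proof.
move=> [Bx x2].
have nearB : \forall s \near (0 : R), 0 < B (x + s *: y) (x + s *: y).
  by have /cvgr_gt/(_ _ Bx) := @surface_form_line_cvg x y.
have near2 : \forall s \near (0 : R), k <= 0 -> 0 < (x + s *: y) 0 2.
  have [k0|k0] := pselect (k <= 0); last by near=> s => /k0.
  have c2 : x 0 2 + s * y 0 2 @[s --> (0 : R)] --> x 0 2.
    have id0 : s @[s --> (0 : R)] --> (0 : R) by exact: cvg_id.
    have := cvgD (cvg_cst (x 0 2)) (cvgM id0 (cvg_cst (y 0 2))).
    by rewrite mul0r addr0; apply.
  near=> s => _; rewrite !mxE; near: s.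
  by move: c2 => /cvgr_gt/(_ _ (x2 k0)).
by near=> s; split; near: s.
Unshelve. all: by end_near. Qed.

Lemma normalize_cvg x y : open_cone x ->
  normalize (x + s *: y) @[s --> (0 : R)] --> normalize x.
Proof.
move=> [Bx _]; apply: cvgZ; last exact: line_cvg.
apply: cvgV; first by rewrite gt_eqF // sqrtr_gt0.
apply: (@cvg_comp _ _ _ (fun s => B (x + s *: y) (x + s *: y)) Num.sqrt).
  exact: surface_form_line_cvg.
exact: sqrt_continuous.
Qed.

End SurfaceForm.

(** * Coordinates in the basis of the rows of a matrix *)

Section FrameCoordinates.
Variables (R : realType).
Local Notation V := 'rV[R]_3.
Implicit Types (M N : 'M[R]_3) (x : V).

Definition coord M x : V := x *m invmx M.

Definition row_set M : set V := range (fun i => row i M).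

Lemma coordK M x : M \in unitmx -> x = \sum_i coord M x 0 i *: row i M.
Proof. by move=> Mu; rewrite -mulmx_sum_row mulmxKV. Qed.

Lemma coord_row M i : M \in unitmx -> coord M (row i M) = delta_mx 0 i.
Proof. by move=> Mu; rewrite /coord -row_mul mulmxV // rowE mulmx1. Qed.

Lemma coordD M x y i : coord M (x + y) 0 i = coord M x 0 i + coord M y 0 i.
Proof. by rewrite /coord mulmxDl [LHS]mxE. Qed.

Lemma coordZ M r x i : coord M (r *: x) 0 i = r * coord M x 0 i.
Proof. by rewrite /coord -scalemxAl [LHS]mxE. Qed.

Lemma hull_cone_coord M x : M \in unitmx ->
  hull_cone (row_set M) x <-> forall i, 0 <= coord M x 0 i.
Proof.
move=> Mu; split.
  move=> [a [b [c [s [t [u [[[i _ <-] [j _ <-] [l _ <-]] [[s0 t0 u0] ->]]]]]]]] r.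
  rewrite !coordD !coordZ !coord_row // !mxE /=.
  by rewrite !addr_ge0 // mulr_ge0 // ler0n.
move=> x0; exists (row 0 M), (row 1 M), (row ord_max M), (coord M x 0 0),
  (coord M x 0 1), (coord M x 0 ord_max); split; first by split; eexists.
by split; [split; exact: x0|rewrite [LHS](coordK x Mu) sum3].
Qed.

Lemma hull_cone_coord0 M (F : set V) x i : M \in unitmx -> F `<=` row_set M ->
  hull_cone F x -> ~ F (row i M) -> coord M x 0 i = 0.
Proof.
move=> Mu FM [a [b [c [s [t [u [[Fa Fb Fc] [_ ->]]]]]]]] nFi.
have coord0 v : F v -> coord M v 0 i = 0.
  move=> Fv; have [j _ vj] := FM v Fv; rewrite -vj coord_row // mxE /=.
  by case: eqP => // ij; move: nFi; rewrite ij vj.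
by rewrite !coordD !coordZ !coord0 // !mulr0 !addr0.
Qed.

Lemma row_inj M i j : M \in unitmx -> row i M = row j M -> i = j.
Proof.
move=> Mu ij; have := coord_row j Mu; rewrite -ij coord_row //.
by move=> /rowP/(_ i); rewrite !mxE !eqxx /=; case: eqP => // _ /eqP; rewrite oner_eq0.
Qed.

Definition rows3 (a b c : V) : 'M[R]_3 :=
  \matrix_(i, j) nth 0 [:: a; b; c] i 0 j.

Lemma row_rows3 a b c i : row i (rows3 a b c) = nth 0 [:: a; b; c] i.
Proof. by apply/rowP => j; rewrite !mxE. Qed.

Lemma row_set_rows3 a b c : row_set (rows3 a b c) = [set a; b; c].
Proof.
apply/seteqP; split=> [_ [i _ <-]|v] /=.
  by rewrite row_rows3; elim/ord3_ind: i; [left; left|left; right|right].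
case=> [[->|->]|->]; [exists 0|exists 1|exists ord_max] => //; exact: row_rows3.
Qed.

Lemma unitmx_rows3 a b c : free [:: a; b; c] -> rows3 a b c \in unitmx.
Proof.
move=> /(@freeP _ _ _ [tuple of [:: a; b; c]]) abc_free.
rewrite -row_free_unit; apply: inj_row_free => v v0.
apply/rowP => i; rewrite mxE; apply: abc_free.
by apply: etrans v0; rewrite mulmx_sum_row; apply: eq_bigr => j _; rewrite row_rows3.
Qed.

End FrameCoordinates.

Section Surfaces.
Variables (R : realType) (k : R).
Hypothesis curv : [\/ k = 1, k = 0 | k = - 1].
Local Notation V := 'rV[R]_3.
Local Notation B := (surface_form k).
Implicit Types (x y v : V).

Lemma rV3_eq x y : x 0 0 = y 0 0 -> x 0 1 = y 0 1 -> x 0 2 = y 0 2 -> x = y.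
Proof.
move=> x0 x1 x2; apply/rowP; elim/ord3_ind => //.
by have -> : ord_max = 2 :> 'I_3 by exact/val_inj.
Qed.

Lemma chord2C x y : chord2 k x y = chord2 k y x.
Proof. by rewrite /chord2; ring. Qed.

Lemma surface_flat x : k = 0 -> surface k x -> x 0 2 = 1.
Proof.
move=> k0 [+ /(_ _)]; rewrite /surface_form k0 lexx => + /(_ isT); nra.
Qed.

Lemma surface_form_chord2 x y : surface k x -> surface k y ->
  B x y = 1 - k * chord2 k x y / 2.
Proof.
move=> Sx Sy; case: (curv) => k0.
- case: Sx Sy => [+ _] [+ _]; rewrite /chord2 /surface_form k0; lra.
- have := surface_flat k0 Sx; have := surface_flat k0 Sy.
  by rewrite /surface_form k0 => -> ->; lra.
- case: Sx Sy => [+ _] [+ _]; rewrite /chord2 /surface_form k0; lra.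
Qed.

Lemma chord2_gt0 x y : surface k x -> surface k y -> x != y -> 0 < chord2 k x y.
Proof.
move=> Sx Sy /eqP neq_xy; rewrite ltNge; apply/negP => le0; apply: neq_xy.
have sq0 (u v w : R) : u ^+ 2 + v ^+ 2 + w ^+ 2 <= 0 -> [/\ u = 0, v = 0 & w = 0].
  move=> uvw; have := sqr_ge0 u; have := sqr_ge0 v; have := sqr_ge0 w => w2 v2 u2.
  by split; apply/eqP; rewrite -sqrf_eq0 eq_le sqr_ge0 andbT; lra.
case: (curv) => kE; rewrite /chord2 kE in le0.
- by have [] := sq0 _ _ _ (eq_ind_r (fun c => _ + c <= 0) le0 (esym (mul1r _))) => *;
    apply: rV3_eq; lra.
- rewrite mul0r addr0 in le0.
  have [] := sq0 (x 0 0 - y 0 0) (x 0 1 - y 0 1) 0 _; first by rewrite expr0n addr0.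
  move=> ? ? _; apply: rV3_eq; [lra|lra|].
  by rewrite !surface_flat.
have kN : k <= 0 by rewrite kE; lra.
case: Sx => + /(_ kN); case: Sy => + /(_ kN); rewrite /surface_form kE.
move=> By y2 Bx x2; have xy2 := mulr_gt0 x2 y2.
set a := x 0 0 in Bx le0 *; set b := x 0 1 in Bx le0 *; set c := x 0 2 in Bx x2 xy2 le0 *.
set a' := y 0 0 in By le0 *; set b' := y 0 1 in By le0 *; set c' := y 0 2 in By y2 xy2 le0 *.
have le_w : c * c' <= 1 + a * a' + b * b' by lra.
have le_w2 : (c * c') ^+ 2 <= (1 + a * a' + b * b') ^+ 2.
  by rewrite ler_pXn2r // ?nnegrE; lra.
have cE : (c * c') ^+ 2 = (1 + a ^+ 2 + b ^+ 2) * (1 + a' ^+ 2 + b' ^+ 2).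
  by rewrite exprMn !expr2; congr (_ * _); lra.
(* Lagrange's identity for (1, a, b) and (1, a', b') turns the inequality into the vanishing of
   three squares. *)
have [] := sq0 (a - a') (b - b') (a * b' - b * a') _.
  have -> : (a - a') ^+ 2 + (b - b') ^+ 2 + (a * b' - b * a') ^+ 2 =
    (c * c') ^+ 2 - (1 + a * a' + b * b') ^+ 2 by rewrite cE; ring.
  by rewrite subr_le0.
move=> aE bE _; have {}aE : a = a' by lra.
have {}bE : b = b' by lra.
apply: rV3_eq => //; rewrite -/c -/c'.
have : (c - c') * (c + c') = 0.
  rewrite aE bE in Bx; have -> : (c - c') * (c + c') = c * c - c' * c' by ring.
  lra.
by move/eqP; rewrite mulf_eq0 => /orP[/eqP|/eqP]; lra.
Qed.

(** For k = -1 this is the reversed Cauchy-Schwarz inequality in the future light cone. *)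
Lemma surface_form_gt0 x y : k <= 0 -> open_cone k x -> open_cone k y -> 0 < B x y.
Proof.
move=> k0 [+ /(_ k0) x2] [+ /(_ k0) y2]; have xy2 := mulr_gt0 x2 y2.
rewrite /surface_form; case: (curv) => kE; [lra|by rewrite kE !mul0r !add0r|].
rewrite kE; set a := x 0 0; set b := x 0 1; set c := x 0 2 in x2 xy2 *.
set a' := y 0 0; set b' := y 0 1; set c' := y 0 2 in y2 xy2 *.
move=> Bx By; rewrite ltNge; apply/negP => le0.
have le_w : c * c' <= a * a' + b * b' by lra.
have : (c * c') ^+ 2 <= (a * a' + b * b') ^+ 2.
  by rewrite ler_pXn2r // ?nnegrE; lra.
apply/negP; rewrite -ltNge.
have : (a * a' + b * b') ^+ 2 <= (a ^+ 2 + b ^+ 2) * (a' ^+ 2 + b' ^+ 2).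
  rewrite -subr_ge0; have -> : (a ^+ 2 + b ^+ 2) * (a' ^+ 2 + b' ^+ 2) -
    (a * a' + b * b') ^+ 2 = (a * b' - b * a') ^+ 2 by ring.
  exact: sqr_ge0.
move=> /le_lt_trans; apply; rewrite exprMn.
by apply: ltr_pM; rewrite ?addr_ge0 ?sqr_ge0 // !expr2; lra.
Qed.

(** On the sphere this convexity fails for opposite vectors, hence the separate treatment of k = 1
    in later proofs. *)
Lemma open_coneD x y : k <= 0 -> open_cone k x -> open_cone k y -> open_cone k (x + y).
Proof.
move=> k0 ox oy; have Bxy := surface_form_gt0 k0 ox oy.
case: ox oy => [Bx x2] [By y2]; split; last by move=> _; rewrite mxE addr_gt0 ?x2 ?y2.
by rewrite !surface_formE (surface_formC _ y); lra.
Qed.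

Lemma open_cone_sphere x : k = 1 -> x != 0 -> open_cone k x.
Proof.
move=> kE xn0; split; last by rewrite kE; lra.
have := sqr_ge0 (x 0 0); have := sqr_ge0 (x 0 1); have := sqr_ge0 (x 0 2).
move=> x2 x1 x0; rewrite /surface_form kE lt_def; apply/andP; split; last by lra.
apply: contra xn0 => /eqP Bx0; apply/eqP/rV3_eq; rewrite !mxE; apply/eqP;
  rewrite -sqrf_eq0 eq_le sqr_ge0 andbT; lra.
Qed.

End Surfaces.

(** * Rodrigues' formula and orientation *)

Section Rodrigues.
Variables (R : realType) (k : R).
Hypothesis curv : [\/ k = 1, k = 0 | k = - 1].
Local Notation V := 'rV[R]_3.
Local Notation B := (surface_form k).
Implicit Types (a b c x y : V).

Definition det3 a b c : R :=
  a 0 0 * (b 0 1 * c 0 2 - b 0 2 * c 0 1) + a 0 1 * (b 0 2 * c 0 0 - b 0 0 * c 0 2) +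
  a 0 2 * (b 0 0 * c 0 1 - b 0 1 * c 0 0).

Lemma det3E (M : 'M[R]_3) : \det M = det3 (row 0 M) (row 1 M) (row ord_max M).
Proof.
rewrite (expand_det_row _ 0) sum3 /cofactor.
rewrite !(expand_det_row _ 0) !big_ord_recl !big_ord0 /cofactor !det_mx11 !mxE /=.
pose f p q := M (inord p) (inord q).
have fE i j : M i j = f (val i) (val j) by rewrite /f !inord_val.
by rewrite /det3 !mxE !fE /=; ring.
Qed.

Lemma det_turn_mx (r : R) : \det (turn_mx r) = 1.
Proof. by rewrite det3E /det3 !mxE /=; ring. Qed.

(* The metric of the surface: [chord2 x y] is the square of [x - y]. *)
Definition tangent_form x y : R := x 0 0 * y 0 0 + x 0 1 * y 0 1 + k * (x 0 2 * y 0 2).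

Lemma tangent_turn a x y : B a a = 1 -> B a x = 0 -> B a y = 0 ->
  tangent_form x x *: y = tangent_form x y *: x + det3 a x y *: twisted_cross k a x /\
  det3 a x y ^+ 2 = tangent_form x x * tangent_form y y - tangent_form x y ^+ 2.
Proof.
rewrite /surface_form /tangent_form /det3.
set a0 := a 0 0; set a1 := a 0 1; set a2 := a 0 2.
set x0 := x 0 0; set x1 := x 0 1; set x2 := x 0 2.
set y0 := y 0 0; set y1 := y 0 1; set y2 := y 0 2.
move=> aa ax ay.
pose w0 := x1 * y2 - x2 * y1; pose w1 := x2 * y0 - x0 * y2.
pose w2 := x0 * y1 - x1 * y0; pose D := a0 * w0 + a1 * w1 + a2 * w2.
pose q := k * (a0 * x0 + a1 * x1) + a2 * x2; pose p := k * (a0 * y0 + a1 * y1) + a2 * y2.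
(* The vectors [x] and [y] are orthogonal to (k a0, k a1, a2), so their cross product [w] is a
   multiple of it. Pairing with [a], on which this covector is 1, shows that the factor is [D]. *)
have w0E : w0 = D * (k * a0).
  have : w0 * (k * (a0 * a0 + a1 * a1) + a2 * a2) = D * (k * a0) -
    (a1 * (x2 * p - y2 * q) - a2 * (x1 * p - y1 * q)).
    by rewrite /D /w0 /w1 /w2 /p /q; ring.
  by rewrite aa /p /q ax ay => wE; lra.
have w1E : w1 = D * (k * a1).
  have : w1 * (k * (a0 * a0 + a1 * a1) + a2 * a2) = D * (k * a1) -
    (a2 * (x0 * p - y0 * q) - a0 * (x2 * p - y2 * q)).
    by rewrite /D /w0 /w1 /w2 /p /q; ring.
  by rewrite aa /p /q ax ay => wE; lra.
have w2E : w2 = D * a2.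
  have : w2 * (k * (a0 * a0 + a1 * a1) + a2 * a2) = D * a2 -
    (a0 * (x1 * p - y1 * q) - a1 * (x0 * p - y0 * q)).
    by rewrite /D /w0 /w1 /w2 /p /q; ring.
  by rewrite aa /p /q ax ay => wE; lra.
(* For k = 0 this holds because then x 0 2 = 0. *)
have kk : k * k * x2 = x2 /\ k * k * k * (a0 * a0 + a1 * a1) + a2 * a2 = 1.
  case: (curv) => kE; [by split; rewrite -?aa kE; ring| |by split; rewrite -?aa kE; ring].
  rewrite kE mul0r add0r in aa; rewrite kE mul0r add0r in ax.
  have a2n0 : a2 != 0 by apply/eqP => a20; rewrite a20 mul0r in aa; lra.
  have -> : x2 = 0 by apply: (mulfI a2n0); rewrite ax mulr0.
  by rewrite kE !mul0r add0r; split; lra.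
have [kk1 kk2] := kk.
rewrite -/w0 -/w1 -/w2 -/D; split.
  apply: rV3_eq; rewrite !mxE /= -/a0 -/a1 -/a2 -/x0 -/x1 -/x2 -/y0 -/y1 -/y2.
  - have -> : (x0 * x0 + x1 * x1 + k * (x2 * x2)) * y0 =
      (x0 * y0 + x1 * y1 + k * (x2 * y2)) * x0 - x1 * w2 + k * x2 * w1.
      by rewrite /w1 /w2; ring.
    have -> : k * x2 * w1 = D * a1 * (k * k * x2) by rewrite w1E; ring.
    rewrite w2E kk1; ring.
  - have -> : (x0 * x0 + x1 * x1 + k * (x2 * x2)) * y1 =
      (x0 * y0 + x1 * y1 + k * (x2 * y2)) * x1 + x0 * w2 - k * x2 * w0.
      by rewrite /w0 /w2; ring.
    have -> : k * x2 * w0 = D * a0 * (k * k * x2) by rewrite w0E; ring.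
    rewrite w2E kk1; ring.
  - have -> : (x0 * x0 + x1 * x1 + k * (x2 * x2)) * y2 =
      (x0 * y0 + x1 * y1 + k * (x2 * y2)) * x2 - x0 * w1 + x1 * w0.
      by rewrite /w0 /w1; ring.
    rewrite w0E w1E; ring.
transitivity (w2 ^+ 2 + k * (w0 ^+ 2 + w1 ^+ 2)); last by rewrite /w0 /w1 /w2; ring.
rewrite w0E w1E w2E -[LHS]mulr1 -kk2; ring.
Qed.

Lemma tangent_rotation a x y (th h : R) : B a a = 1 -> B a x = 0 -> B a y = 0 ->
  0 < h -> tangent_form x x = h -> tangent_form y y = h ->
  tangent_form x y = cos th * h -> 0 < sin th -> 0 < det3 a x y ->
  y = cos th *: x + sin th *: twisted_cross k a x.
Proof.
move=> aa ax ay h0 xx yy xy s0 D0.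
have [yE D2] := tangent_turn aa ax ay.
have hn0 : h != 0 by rewrite gt_eqF.
(* The Gram identity gives this up to sign; the positive determinant selects the counterclockwise
   rotation. *)
have DE : det3 a x y = sin th * h.
  apply/eqP; rewrite -(eqrXn2 (n := 2)) ?(ltW D0) ?mulr_ge0 ?(ltW s0) ?(ltW h0) //.
  rewrite D2 xx yy xy !exprMn; apply/eqP.
  have -> : sin th ^+ 2 = 1 - cos th ^+ 2 by rewrite -(cos2Dsin2 th); ring.
  by ring.
apply: (scalerI hn0); rewrite -{1}xx yE xy DE scalerDr !scalerA.
by rewrite ![h * _]mulrC.
Qed.

End Rodrigues.

(** * Frames of a tessellation *)

Section Tessellation.
Variables (R : realType) (k : R) (m : nat) (T : set (set 'rV[R]_3)) (d : R).
Hypothesis curv : [\/ k = 1, k = 0 | k = - 1].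
Hypothesis tess : regular_tessellation k m T.
Hypothesis equil : forall F, T F -> equilateral_triangle k d F.
Local Notation V := 'rV[R]_3.
Local Notation B := (surface_form k).
Implicit Types (M N : 'M[R]_3) (x y v : V) (F : set V).

Definition frame M := M \in unitmx /\ T (row_set M).

(* [g] is the value of the form at two vertices of a face, and the face on the
   other side of the edge {a, b} of {a, b, c} is {a, b, lam (a + b) - c}. *)
Let g : R := 1 - k * d / 2.
Let lam : R := 2 * g / (1 + g).

Lemma face_frame F : T F -> exists2 M, frame M & F = row_set M.
Proof.
move=> TF; have [a [b [c [FE _ abc_free _]]]] := equil TF.
exists (rows3 a b c); last by rewrite row_set_rows3.
by split; [exact: unitmx_rows3|rewrite row_set_rows3 -FE].
Qed.

Lemma frame_surface M i : frame M -> surface k (row i M).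
Proof.
by move=> [_ TM]; have [a [b [c [_ sub _ _]]]] := equil TM; apply: sub; exists i.
Qed.

Lemma frame_chord2 M i j : frame M -> i != j -> chord2 k (row i M) (row j M) = d.
Proof.
move=> [Mu TM] ij; have [a [b [c [FE _ _ [ab bc ca]]]]] := equil TM.
have Mi : [set a; b; c] (row i M) by rewrite -FE; exists i.
have Mj : [set a; b; c] (row j M) by rewrite -FE; exists j.
have {ij} : row i M <> row j M by move=> /(row_inj Mu)/eqP; apply/negP.
case: Mi => [[->|->]|->]; case: Mj => [[->|->]|->] //; by rewrite // chord2C.
Qed.

Lemma frame_form1 M i : frame M -> B (row i M) (row i M) = 1.
Proof. by move=> fM; case: (frame_surface i fM). Qed.

Lemma frame_form M i j : frame M -> i != j -> B (row i M) (row j M) = g.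
Proof.
move=> fM ij; rewrite (surface_form_chord2 curv) ?frame_chord2 //.
all: exact: frame_surface.
Qed.

Lemma side_gt0 M : frame M -> 0 < d.
Proof.
move=> fM; have [Mu _] := fM.
rewrite -(@frame_chord2 M 0 1 fM) //; apply: chord2_gt0 => //; try exact: frame_surface.
by apply/eqP => /(row_inj Mu)/eqP.
Qed.

Lemma cone_open M x : frame M -> (forall i, 0 <= coord M x 0 i) -> x != 0 ->
  open_cone k x.
Proof.
move=> fM x0 xn0; have [Mu _] := fM.
have [k1|k0] : k = 1 \/ k <= 0 by case: curv => ->; [left|right|right]; lra.
  exact: open_cone_sphere.
pose P y := y = 0 \/ open_cone k y.
have PD y z : P y -> P z -> P (y + z).
  case=> [->|oy]; first by rewrite add0r.
  by case=> [->|oz]; [rewrite addr0|]; right => //; exact: open_coneD.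
have Prow i : P (coord M x 0 i *: row i M).
  have [c0|cn0] := eqVneq (coord M x 0 i) 0; first by left; rewrite c0 scale0r.
  right; apply: open_coneZ; first by rewrite lt_def cn0 x0.
  exact/surface_open_cone/frame_surface.
have : P x by rewrite (coordK x Mu) sum3; exact: PD (PD _ _ (Prow _) (Prow _)) (Prow _).
by case=> // x00; rewrite x00 eqxx in xn0.
Qed.

(** On the sphere the sum of the three vertices is nonzero and its norm squared is 3 + 6 g;
    otherwise g is at least 1. The bound is equivalent to lam / 2 > -1 once 1 + g is positive, so
    that a face has an angle less than pi. *)
Lemma gram_bound M : frame M -> - 1 / 2 < g.
Proof.
move=> fM; have [Mu _] := fM; have d0 := side_gt0 fM.
case: curv => kE; rewrite /g kE; [|lra|lra].
have : open_cone k (row 0 M + row 1 M + row ord_max M).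
  apply: (cone_open fM).
    by move=> i; rewrite !coordD !coord_row // !mxE !addr_ge0.
  apply/eqP => /(congr1 (fun v => coord M v 0 0)).
  rewrite !coordD !coord_row // /coord mul0mx !mxE /=; lra.
case=> + _; rewrite !surface_formE !frame_form1 // !frame_form //.
rewrite /g kE; lra.
Qed.

(** A common point lies in the cone of the common vertices, so its coordinates along the other
    vertices vanish by linear independence. *)
Lemma common_vertex M N x i : frame M -> frame N -> open_cone k x ->
  hull_cone (row_set M) x -> hull_cone (row_set N) x ->
  0 < coord M x 0 i -> row_set N (row i M).
Proof.
move=> fM fN ox hM hN xi; have [Mu TM] := fM; have [_ TN] := fN.
apply: contrapT => nNi.
have h : (geodesic_hull k (row_set M) `&` geodesic_hull k (row_set N)) (normalize k x).
  by split; apply/geodesic_hullE; (split; [exact: normalize_surface|]);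
     apply/hull_cone_normalize.
move: h; rewrite (tess_face_to_face tess TM TN) => /geodesic_hullE[_].
move=> /(hull_cone_normalize _ ox) hMN.
have := hull_cone_coord0 Mu (@subIsetl _ _ _) hMN (i := i).
by move=> x0; rewrite x0 ?ltxx // in xi; case.
Qed.

(* Faces are closed and locally finite, so the faces at a nearby point contain
   the point itself. *)
Lemma near_face x y : open_cone k x -> \forall s \near (0 : R),
  open_cone k (x + s *: y) /\
  forall F, T F -> hull_cone F (x + s *: y) -> hull_cone F x.
Proof.
move=> ox; have [U nU finU] := tess_locally_finite tess (normalize_surface ox).
have nearU := normalize_cvg y ox nU.
have near_o := near_open_cone y ox.
(* A face missing the point has a negative coordinate there, which stays negative nearby. *)
have near1 F : T F /\ geodesic_hull k F `&` U !=set0 ->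
    \forall s \near (0 : R), hull_cone F (x + s *: y) -> hull_cone F x.
  move=> [TF _].
  have [M [Mu _] ->] := face_frame TF.
  have [hx|nhx] := pselect (hull_cone (row_set M) x); first by near=> s.
  move/(hull_cone_coord _ Mu)/existsNP: nhx => [i /negP]; rewrite -ltNge => xi.
  have id0 : s @[s --> (0 : R)] --> (0 : R) by exact: cvg_id.
  have coord_cvg : coord M x 0 i + s * coord M y 0 i @[s --> (0 : R)] --> coord M x 0 i.
    have := cvgD (cvg_cst (coord M x 0 i)) (cvgM id0 (cvg_cst (coord M y 0 i))).
    by rewrite mul0r addr0; apply.
  have near_i := cvgr_lt _ coord_cvg _ xi.
  near=> s => /(hull_cone_coord _ Mu)/(_ i); rewrite coordD coordZ => si.
  suff : coord M x 0 i + s * coord M y 0 i < 0 by rewrite ltNge si.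
  near: s; exact: near_i.
have nearA := near_finite finU near1.
near=> s; have os : open_cone k (x + s *: y) by near: s.
split=> // F TF hF; have sA := near nearA s; apply: sA => //.
split=> //; exists (normalize k (x + s *: y)); split.
  by apply/geodesic_hullE; split; [exact: normalize_surface|apply/hull_cone_normalize].
by near: s.
Unshelve. all: by end_near. Qed.

Lemma face_cover x : open_cone k x -> exists2 F, T F & hull_cone F x.
Proof.
move=> ox; have [F TF /geodesic_hullE[_ hF]] := tess_cover tess (normalize_surface ox).
by exists F => //; apply/(hull_cone_normalize _ ox).
Qed.

Local Notation s_ := (simple_mx lam).

Lemma row_set3 M : row_set M = [set row 0 M; row 1 M; row ord_max M].
Proof.
apply/seteqP; split=> [_ [i _ <-]|v /=]; last by case=> [[->|->]|->]; eexists.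
by elim/ord3_ind: i; [left; left|left; right|right].
Qed.

Lemma row_set_simple0 M : row_set (s_ ord0 * M) = row_set M.
Proof. by rewrite !row_set3 !row_simple0 /= [[set row 1 M; _]]setUC. Qed.

Lemma row_set_simple1 M : row_set (s_ 1 * M) = row_set M.
Proof. by rewrite !row_set3 !row_simple1 /= setUAC. Qed.

Lemma frame_eqset M N : frame M -> N \in unitmx -> row_set N = row_set M -> frame N.
Proof. by move=> [_ TM] Nu NM; split; rewrite // NM. Qed.

Lemma frame_simple0 M : frame M -> frame (s_ ord0 * M).
Proof.
move=> fM; apply: (frame_eqset fM); last exact: row_set_simple0.
by rewrite unitmx_mul (simple_mx_unit lam ord0); case: fM.
Qed.

Lemma frame_simple1 M : frame M -> frame (s_ 1 * M).
Proof.
move=> fM; apply: (frame_eqset fM); last exact: row_set_simple1.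
by rewrite unitmx_mul (simple_mx_unit lam 1); case: fM.
Qed.

Lemma frame_reorder M i j : frame M -> i != j -> exists u, let N := word_mx lam u * M in
  [/\ frame N, row_set N = row_set M, row 0 N = row i M & row 1 N = row j M].
Proof.
move=> fM ij; suff [u [ufr u0 u1]] : exists u,
    [/\ all (predC1 ord_max) u, row 0 (word_mx lam u * M) = row i M
      & row 1 (word_mx lam u * M) = row j M].
  exists u; split=> //; [move: ufr => {u0 u1}|].
    elim: u => [_|l u IHu /= /andP[l2 /IHu fu]]; first by rewrite word_mx_nil.
    rewrite word_mx_cons; elim/ord3_ind: l l2 => // _; first exact: frame_simple0.
    exact: frame_simple1.
  elim: u ufr {u0 u1} => [_|l u IHu /= /andP[l2 /IHu fu]]; first by rewrite word_mx_nil.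
  rewrite word_mx_cons -fu; elim/ord3_ind: l l2 => // _; first exact: row_set_simple0.
  exact: row_set_simple1.
elim/ord3_ind: i ij; elim/ord3_ind: j => // _;
  [exists [::]|exists [:: 1]|exists [:: ord0]|exists [:: 1; ord0]|exists [:: ord0; 1]|
   exists [:: ord0; 1; ord0]]; split=> //; rewrite ?word_mx_cons word_mx_nil;
  by rewrite ?(row_simple0, row_simple1) /= ?(row_simple0, row_simple1) /=
    ?(row_simple0, row_simple1).
Qed.

(** The values of the form give two linear equations and a quadratic one for the coordinates of the
    third vertex, with z = 1 or z = -1 once g differs from 1 and from -1/2. *)
Lemma third_vertex M N : frame M -> frame N -> row 0 N = row 0 M -> row 1 N = row 1 M ->
  row ord_max N = row ord_max M \/ row ord_max N = row ord_max (s_ ord_max * M).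
Proof.
move=> fM fN N0 N1; have [Mu _] := fM.
have d0 := side_gt0 fM; have gb := gram_bound fM.
have cE := coordK (row ord_max N) Mu; rewrite sum3 in cE.
set x := coord _ _ 0 0 in cE; set y := coord _ _ 0 1 in cE; set z := coord _ _ 0 ord_max in cE.
rewrite row_simple2 /=.
set a := row 0 M in cE N0 *; set b := row 1 M in cE N1 *; set c := row ord_max M in cE *.
have aa : B a a = 1 by exact: frame_form1.
have bb : B b b = 1 by exact: frame_form1.
have cc : B c c = 1 by exact: frame_form1.
have ab : B a b = g by exact: frame_form.
have ba : B b a = g by exact: frame_form.
have ac : B a c = g by exact: frame_form.
have ca : B c a = g by exact: frame_form.
have bc : B b c = g by exact: frame_form.
have cb : B c b = g by exact: frame_form.
suff : (x = 0 /\ y = 0) /\ z = 1 \/ (x = lam /\ y = lam) /\ z = -1.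
  case=> [[[xE yE] zE]|[[xE yE] zE]]; [left|right]; rewrite cE xE yE zE.
    by rewrite !scale0r !add0r scale1r.
  by rewrite scaleN1r scalerDr.
have e1 : x + g * y + g * z = g.
  by rewrite -{3}(frame_form (i := ord_max) (j := 0) fN) // N0 cE !surface_formE aa ba ca; ring.
have e2 : g * x + y + g * z = g.
  by rewrite -{3}(frame_form (i := ord_max) (j := 1) fN) // N1 cE !surface_formE ab bb cb; ring.
have e3 : x ^+ 2 + y ^+ 2 + z ^+ 2 + 2 * g * (x * y + y * z + x * z) = 1.
  rewrite -[RHS](frame_form1 ord_max fN) cE !surface_formE aa bb cc ab ba ac ca bc cb; ring.
have g1 : 0 < 1 + g by lra.
have xy_lam : x = y -> z = -1 -> x * (1 + g) = g * (1 - z) -> x = lam /\ y = lam.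
  move=> <- -> xg; have -> : x = lam; last by [].
  have gn0 : 1 + g != 0 by rewrite gt_eqF.
  by apply: (mulIf gn0); rewrite xg /lam divfK ?gt_eqF //; ring.
(* In the plane the form only sees the last coordinate, so squared distances are used instead; [e4]
   and [e5] expand them from the vertices a and b. *)
have [k0|kn0] := eqVneq k 0.
  have gE : g = 1 by rewrite /g k0; lra.
  have xE : x = 1 - y - z by rewrite gE in e1; lra.
  have chordE v w : chord2 k v w = (v 0 0 - w 0 0) ^+ 2 + (v 0 1 - w 0 1) ^+ 2.
    by rewrite /chord2 k0 mul0r addr0.
  have dn0 : d != 0 by rewrite gt_eqF.
  have dba : chord2 k b a = d by exact: frame_chord2.
  have dca : chord2 k c a = d by exact: frame_chord2.
  have dbc : chord2 k b c = d by exact: frame_chord2.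
  have e4 : y ^+ 2 + z ^+ 2 + y * z = 1.
    apply: (mulfI dn0); have -> : d * (y ^+ 2 + z ^+ 2 + y * z) =
      y ^+ 2 * chord2 k b a + z ^+ 2 * chord2 k c a +
      y * z * (chord2 k b a + chord2 k c a - chord2 k b c).
      by rewrite dba dca dbc; ring.
    rewrite mulr1 -[RHS](frame_chord2 (i := ord_max) (j := 0) fN) // N0 cE xE.
    by rewrite !chordE !mxE; ring.
  have e5 : x ^+ 2 + z ^+ 2 + x * z = 1.
    apply: (mulfI dn0); have -> : d * (x ^+ 2 + z ^+ 2 + x * z) =
      x ^+ 2 * chord2 k b a + z ^+ 2 * chord2 k b c +
      x * z * (chord2 k b a + chord2 k b c - chord2 k c a).
      by rewrite dba dca dbc; ring.
    rewrite mulr1 -[RHS](frame_chord2 (i := ord_max) (j := 1) fN) // N1 cE xE.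
    by rewrite !chordE !mxE; ring.
  have zE : z = 1 - 2 * y by rewrite xE in e5; lra.
  have : y * (y - 1) = 0 by rewrite zE in e4; lra.
  move/eqP; rewrite mulf_eq0 => /orP[|] /eqP yE; [left|right].
    by split; [split|]; lra.
  have z1 : z = -1 by lra.
  by split => //; apply: xy_lam => //; rewrite ?gE; lra.
have gn1 : g != 1.
  by rewrite /g -subr_eq0 addrAC subrr add0r oppr_eq0 !mulf_neq0 ?invr_eq0 // gt_eqF.
have xyE : x = y.
  have : (x - y) * (1 - g) = 0.
    have -> : (x - y) * (1 - g) = (x + g * y + g * z) - (g * x + y + g * z) by ring.
    by rewrite e1 e2 subrr.
  move/eqP; rewrite mulf_eq0 !subr_eq0 (eq_sym 1) (negPf gn1) orbF.
  by move/eqP.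
have xg : x * (1 + g) = g * (1 - z) by rewrite -xyE in e1; lra.
have : (1 - z) * (1 + z) * ((2 * g + 1) * (g - 1)) = 0.
  have : (1 + g) * (x ^+ 2 + y ^+ 2 + z ^+ 2 + 2 * g * (x * y + y * z + x * z)) = (1 + g).
    by rewrite e3 mulr1.
  rewrite -xyE.
  have -> : (1 + g) * (x ^+ 2 + x ^+ 2 + z ^+ 2 + 2 * g * (x * x + x * z + x * z)) =
    2 * (x * (1 + g)) ^+ 2 + 4 * g * z * (x * (1 + g)) + z ^+ 2 * (1 + g) by ring.
  by rewrite xg => e; lra.
move/eqP; rewrite !mulf_eq0 => /orP[/orP[|]|/orP[|]] /eqP zE.
- left; have z1 : z = 1 by lra.
  have x0 : x = 0 by rewrite z1 subrr mulr0 in xg; move/eqP: xg;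
    rewrite mulf_eq0 (gt_eqF g1) orbF => /eqP.
  by rewrite -xyE x0.
- right; have z1 : z = -1 by lra.
  by split => //; exact: xy_lam.
- by lra.
- by move: gn1; rewrite -subr_eq0 zE eqxx.
Qed.

(** The midpoint of the edge is pushed slightly away from the third vertex. A face at the new point
    contains the midpoint, hence both ends of the edge; it is not the original face, where the new
    point has a negative coordinate. *)
Lemma frame_simple2 M : frame M -> frame (s_ ord_max * M).
Proof.
move=> fM; have [Mu TM] := fM.
pose x := row 0 M + row 1 M.
have xM i : coord M x 0 i = (i != ord_max)%:R.
  by rewrite coordD !coord_row // !mxE /=; elim/ord3_ind: i; rewrite /= ?addr0 ?add0r.
have ox : open_cone k x.
  apply: (cone_open fM); first by move=> i; rewrite xM.
  apply/eqP => x0; have := xM 0; rewrite x0 /coord mul0mx mxE /= => /eqP.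
  by rewrite eq_sym oner_eq0.
have hx : hull_cone (row_set M) x by apply/hull_cone_coord => // i; rewrite xM.
have [s [s0 [os faces]]] : exists s : R, 0 < s /\ (open_cone k (x + s *: - row ord_max M) /\
    forall F, T F -> hull_cone F (x + s *: - row ord_max M) -> hull_cone F x).
  have /nbhs_ballP[e e0 ball_e] := near_face (- row ord_max M) ox.
  exists (e / 2); split; first by rewrite divr_gt0.
  apply: ball_e; rewrite /ball /= sub0r normrN gtr0_norm ?divr_gt0 //.
  by rewrite ltr_pdivrMr // ltr_pMr // ltr1n.
have [F TF hF] := face_cover os; have [N fN FE] := face_frame TF; rewrite FE in hF.
have hN : hull_cone (row_set N) x by apply: faces => //; case: fN.
have [i _ Ni] : row_set N (row 0 M) by apply: (common_vertex fM fN ox) => //; rewrite xM.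
have [j _ Nj] : row_set N (row 1 M) by apply: (common_vertex fM fN ox) => //; rewrite xM.
have ij : i != j.
  by apply/eqP => ij; move: Nj; rewrite -ij Ni => /(row_inj Mu).
have [u [fN' N'N N'0 N'1]] := frame_reorder fN ij.
set N' := word_mx lam u * N in fN' N'N N'0 N'1.
have [N'2|N'2] := third_vertex fM fN' (etrans N'0 Ni) (etrans N'1 Nj).
  have : hull_cone (row_set M) (x + s *: - row ord_max M).
    by have -> : row_set M = row_set N by rewrite -N'N !row_set3 N'2 N'0 N'1 Ni Nj.
  move/(hull_cone_coord _ Mu)/(_ ord_max); rewrite coordD coordZ xM add0r.
  rewrite /coord mulNmx -/(coord _ _) coord_row // !mxE eqxx /= mulrN1 oppr_ge0.
  by rewrite leNgt s0.
have -> // : s_ ord_max * M = N'.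
by apply/row_matrixP; elim/ord3_ind; rewrite ?N'2 // row_simple2 /= ?N'0 ?N'1 ?Ni ?Nj.
Qed.

(** * The faces around a vertex *)

Local Notation t := (turn_mx lam).

Lemma frame_word u M : frame M -> frame (word_mx lam u * M).
Proof.
move=> fM; elim: u => [|i u IHu]; first by rewrite word_mx_nil.
rewrite word_mx_cons; elim/ord3_ind: i.
- exact: frame_simple0.
- exact: frame_simple1.
- exact: frame_simple2.
Qed.

Lemma frame_turn j M : frame M -> frame (t ^+ j * M).
Proof. by have [u ->] := turn_mx_word lam j; exact: frame_word. Qed.

Lemma coord_mul_row (A M : 'M[R]_3) i : M \in unitmx -> coord M (row i (A * M)) = row i A.
Proof. by move=> Mu; rewrite /coord row_mul mulmxK. Qed.

(** If an edge of one face points into the sector of the other, the faces share these edges: a large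
    multiple of the common vertex is added to [row 1 N], which keeps the direction at the vertex and
    yields a point of both cones. *)
Lemma overlap M N : frame M -> frame N -> row 0 N = row 0 M ->
  0 < coord M (row 1 N) 0 1 -> 0 <= coord M (row 1 N) 0 ord_max ->
  row_set N (row 1 M) /\ row_set M (row 1 N).
Proof.
move=> fM fN N0 v1 v2; have [Mu _] := fM; have [Nu _] := fN.
pose c := 1 + `|coord M (row 1 N) 0 0|; pose q := c *: row 0 M + row 1 N.
have c0 : 0 < c by rewrite ltr_pwDl.
have qN i : coord N q 0 i = nth 0 [:: c; 1; 0] i.
  rewrite coordD coordZ -N0 !coord_row // !mxE.
  by elim/ord3_ind: i => /=; rewrite ?mulr1 ?mulr0 ?addr0 ?add0r.
have qM i : coord M q 0 i = (if i == 0 then c else 0) + coord M (row 1 N) 0 i.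
  rewrite coordD coordZ !coord_row // !mxE.
  by elim/ord3_ind: i => /=; rewrite ?mulr1 ?mulr0.
have oq : open_cone k q.
  apply: (cone_open fN); first by move=> i; rewrite qN; elim/ord3_ind: i => //=; exact: ltW.
  apply/eqP => q0; have := qN 1; rewrite q0 /coord mul0mx mxE /= => /eqP.
  by rewrite eq_sym oner_eq0.
have hM : hull_cone (row_set M) q.
  apply/hull_cone_coord => // i; rewrite qM; elim/ord3_ind: i; rewrite /= ?add0r //.
    by have := ler_norm (- coord M (row 1 N) 0 0); rewrite normrN /c; lra.
  exact: ltW.
have hN : hull_cone (row_set N) q.
  apply/hull_cone_coord => // i; rewrite qN; elim/ord3_ind: i => //=.
  exact: ltW.
split; [apply: (common_vertex fM fN oq)|apply: (common_vertex fN fM oq)] => //.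
  by rewrite qM /= add0r.
by rewrite qN.
Qed.

Lemma ex_angle M : frame M -> exists al, 0 < al < pi /\ lam = 2 * cos al.
Proof.
move=> fM; have gb := gram_bound fM; have g1 : 0 < 1 + g by lra.
have lam_lt : -1 < lam / 2 < 1.
  rewrite /lam; apply/andP; split.
    by rewrite ltr_pdivlMr // ltr_pdivlMr //; lra.
  by rewrite ltr_pdivrMr // ltr_pdivrMr //; lra.
have /andP[l1 l2] := lam_lt.
exists (acos (lam / 2)); split.
  by rewrite acos_gt0 ?acos_ltpi ?l1 ?l2 ?(ltW l1) ?(ltW l2).
rewrite acosK; first by rewrite mulrC divfK // pnatr_eq0.
by rewrite in_itv /= !ltW.
Qed.

Lemma ex_multiple (al x : R) : 0 < al -> 0 <= x ->
  exists j, al *+ j <= x < al *+ j.+1.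
Proof.
move=> al0 x0; have exP : exists j, x < al *+ j.+1.
  exists (Num.bound (x / al)); have := archi_boundP (divr_ge0 x0 (ltW al0)).
  rewrite ltr_pdivrMr // mulrC mulr_natr => /lt_le_trans; apply.
  by rewrite ler_pMn2l.
case: (ex_minnP exP) => j ltx minj; exists j; rewrite ltx andbT.
case: j ltx minj => [|j] ltx minj; first by rewrite mulr0n.
by rewrite leNgt; apply/negP => /minj; rewrite ltnn.
Qed.

Lemma rot_mx_pos (al th : R) : 0 < al < pi -> 0 <= th < al ->
  0 < rot_mx al th 1 1 /\ 0 <= rot_mx al th 1 ord_max.
Proof.
move=> /andP[al0 alpi] /andP[th0 lt_th]; have s0 := sin_al_gt0 al0 alpi.
split; last first.
  rewrite mxE /= divr_ge0 ?(ltW s0) //; apply: sin_ge0_pi.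
  by rewrite th0 ltW // (lt_trans lt_th).
have -> : rot_mx al th 1 1 = sin (al - th) / sin al.
  by rewrite mxE /= sinB; field; rewrite gt_eqF.
rewrite divr_gt0 // sin_gt0_pi // subr_gt0 lt_th /=.
by rewrite (le_lt_trans _ alpi) // gerBl.
Qed.

(** If no multiple of [al] were 2 pi, the first turn beyond 2 pi would put an edge strictly inside
    the sector of the original face, and [overlap] would make its end a vertex of that face. *)
Lemma ex_period M (al : R) : frame M -> 0 < al < pi -> lam = 2 * cos al ->
  exists2 K, (3 <= K)%N & al *+ K = 2 * pi.
Proof.
move=> fM /andP[al0 alpi] lamE; have [Mu _] := fM.
have pi0 := pi_gt0 R; have s0 := sin_al_gt0 al0 alpi.
have [|j /andP[lej ltj]] := @ex_multiple al (2 * pi) al0; first by lra.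
have [|] := eqVneq (al *+ j) (2 * pi).
  move=> jE; exists j => //; rewrite ltnNge; apply/negP => j2.
  have : al *+ j <= al *+ 2 by rewrite ler_wpMn2l // ltW.
  by rewrite jE mulr2n; lra.
move=> ne; pose th := al *+ j.+1 - 2 * pi.
have th0 : 0 < th by rewrite subr_gt0.
have lt_th : th < al.
  by rewrite ltrBlDr mulrS ltrD2l lt_neqAle ne.
have row1 i : coord M (row 1 (t ^+ j.+1 * M)) 0 i = rot_mx al th 1 i.
  rewrite coord_mul_row // mxE lamE turn_mxX // -[in RHS](mulr1 (rot_mx al th)).
  by rewrite -(rot_mx_2pi al) -rot_mxD // subrK.
have [c1 _] : 0 < rot_mx al th 1 1 /\ 0 <= rot_mx al th 1 ord_max.
  by apply: rot_mx_pos; rewrite ?al0 // (ltW th0).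
have c2 : 0 < rot_mx al th 1 ord_max.
  by rewrite mxE /= divr_gt0 // sin_gt0_pi // th0 (lt_trans lt_th).
have fN := frame_turn j.+1 fM.
have N0 := row0_turn lam j.+1 M.
have [||_ [i _ iE]] := overlap fM fN N0; rewrite ?row1 //; first exact: ltW.
move: c1 c2; rewrite -!row1 -iE !coord_row // !mxE.
by elim/ord3_ind: i {iE} => /=; rewrite ltxx.
Qed.

Lemma ex_polar (y z : R) : (y, z) != (0, 0) -> exists r th,
  [/\ 0 < r, 0 <= th, y = r * cos th & z = r * sin th].
Proof.
move=> yz; have r2 : 0 < y ^+ 2 + z ^+ 2.
  rewrite lt_def addr_ge0 ?sqr_ge0 // andbT paddr_eq0 ?sqr_ge0 // !sqrf_eq0.
  by apply: contra yz => /andP[/eqP-> /eqP->].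
pose r := Num.sqrt (y ^+ 2 + z ^+ 2); have r0 : 0 < r by rewrite sqrtr_gt0.
have rE : r ^+ 2 = y ^+ 2 + z ^+ 2 by rewrite sqr_sqrtr ?ltW.
have rn0 : r != 0 by rewrite gt_eqF.
have c_bound : -1 <= y / r <= 1.
  rewrite -ler_norml normrM normfV (gtr0_norm r0) ler_pdivrMr // mul1r.
  by rewrite -ler_sqr ?nnegrE ?(ltW r0) // real_normK ?num_real // rE lerDl sqr_ge0.
have cE : cos (acos (y / r)) = y / r by rewrite acosK.
have acos_pi : 0 <= acos (y / r) <= pi by rewrite acos_ge0 ?acos_lepi.
have sE : r * sin (acos (y / r)) = `|z|.
  have sin0 := sin_ge0_pi acos_pi.
  apply/eqP; rewrite -(eqrXn2 (n := 2)) ?mulr_ge0 ?(ltW r0) //.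
  rewrite real_normK ?num_real // exprMn.
  have -> : sin (acos (y / r)) ^+ 2 = 1 - (y / r) ^+ 2.
    by rewrite -(cos2Dsin2 (acos (y / r))) cE addrC addKr.
  apply/eqP; rewrite exprMn exprVn mulrBr mulr1 mulrCA divff ?sqrf_eq0 // mulr1 rE.
  by rewrite addrC addKr.
have [z0|z0] := leP 0 z.
  exists r, (acos (y / r)); split; rewrite ?cE ?sE ?ger0_norm //.
    by case/andP: acos_pi.
  by rewrite mulrC divfK.
exists r, (2 * pi - acos (y / r)); split=> //.
- by have := pi_gt0 R; case/andP: acos_pi; lra.
- rewrite mulr_natl cosB cos2pi sin2pi mul0r addr0 mul1r cE.
  by rewrite mulrC divfK.
- rewrite mulr_natl sinB cos2pi sin2pi mul0r mul1r sub0r mulrN sE ltr0_norm //.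
  by rewrite opprK.
Qed.

Lemma faces_at_vertex M N : frame M -> frame N -> row 0 N = row 0 M ->
  exists j, row_set N = row_set (t ^+ j * M).
Proof.
move=> fM fN N0; have [Mu _] := fM; have [Nu _] := fN.
have [al [al_pi lamE]] := ex_angle fM; have /andP[al0 alpi] := al_pi.
have [K K3 KE] := ex_period fM al_pi lamE.
have s0 := sin_al_gt0 al0 alpi.
have tK : t ^+ K = 1 by rewrite lamE turn_mxX // KE rot_mx_2pi.
pose v := row 1 N; pose y := coord M v 0 1; pose z := coord M v 0 ord_max.
have vE : v = coord M v 0 0 *: row 0 M + y *: row 1 M + z *: row ord_max M.
  by rewrite [LHS](coordK v Mu) sum3.
(* These are the Cartesian coordinates of [v] modulo row 0, when row 1 is (1, 0) and row 2 is (cos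
   al, sin al). *)
have [|r [th [r0 th0 yE zE]]] := @ex_polar (y + cos al * z) (z * sin al).
  apply/eqP => -[y0 /eqP]; rewrite mulf_eq0 (gt_eqF s0) orbF => /eqP z0.
  rewrite z0 mulr0 addr0 in y0.
  have := congr1 (fun x => coord N x 0 1) vE.
  rewrite /v z0 y0 !scale0r !addr0 -N0 coordZ !coord_row // !mxE /= mulr0.
  by move/eqP; rewrite oner_eq0.
have [j /andP[lej ltj]] := ex_multiple al0 th0.
pose ph := th - al *+ j; pose Mj := t ^+ j * M.
have fMj : frame Mj by exact: frame_turn.
have [Mju _] := fMj.
have Mj0 : row 0 Mj = row 0 M by exact: row0_turn.
have zr : z = r * rot_mx al th 1 ord_max.
  by rewrite mxE /= mulrA -zE mulfK // gt_eqF.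
have yr : y = r * rot_mx al th 1 1.
  have -> : rot_mx al th 1 1 = cos th - cos al * rot_mx al th 1 ord_max by rewrite !mxE.
  by rewrite mulrBr mulrCA -zr -yE addrK.
have vr : v = (coord M v 0 0 - r * rot_mx al th 1 0) *: row 0 M + r *: row 1 (rot_mx al th * M).
  rewrite {1}vE [row 1 (_ * M)]row_mul mulmx_sum_row sum3 ![row 1 _ 0 _]mxE.
  by rewrite !scalerDr !scalerA -zr -yr scalerBl !addrA subrK.
have rotE : rot_mx al th * M = rot_mx al ph * Mj.
  by rewrite /Mj mulrA lamE turn_mxX // -rot_mxD // subrK.
have vMj i : i != 0 -> coord Mj v 0 i = r * rot_mx al ph 1 i.
  move=> i0; rewrite vr rotE -Mj0 coordD !coordZ coord_row // coord_mul_row // !mxE.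
  by rewrite (negPf i0) mulr0 add0r.
have [c1 c2] : 0 < rot_mx al ph 1 1 /\ 0 <= rot_mx al ph 1 ord_max.
  by apply: rot_mx_pos => //; rewrite subr_ge0 lej ltrBlDr -mulrS.
have NMj : row 0 N = row 0 Mj by rewrite N0.
have [||[i _ iE] _] := overlap fMj fN NMj; rewrite ?vMj ?mulr_gt0 ?mulr_ge0 ?(ltW r0) //.
have i0 : 0 != i.
  apply/eqP => i0; move: iE; rewrite -i0 NMj => /(row_inj Mju)/eqP.
  by [].
have [u [fN' N'N N'0 N'1]] := frame_reorder fN i0.
rewrite -N'N; have [N'2|N'2] := third_vertex fMj fN' (etrans N'0 NMj) (etrans N'1 iE).
  by exists j; rewrite !row_set3 N'0 N'1 N'2 NMj iE.
(* Across the edge lies the previous face around the vertex; [K.-1] stands for the exponent -1. *)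
exists (j + K.-1)%N; rewrite addnC exprD.
have -> : t ^+ K.-1 = s_ 1 * s_ ord_max.
  rewrite -turn_mxV; apply: (mulrI (turn_mx_unit lam)).
  by rewrite divrr ?turn_mx_unit // -exprS prednK ?tK // (leq_trans _ K3).
rewrite -!mulrA row_set_simple1 !row_set3 N'0 N'1 N'2 !row_simple2 /= NMj iE.
by [].
Qed.

Lemma vertex_faces M : frame M -> exists (al : R) K,
  [/\ 0 < al < pi, lam = 2 * cos al, al *+ K = 2 * pi, (3 <= K)%N &
      [set F | T F /\ F (row 0 M)] = (fun j => row_set (t ^+ j * M)) @` `I_K].
Proof.
move=> fM; have [al [al_pi lamE]] := ex_angle fM; have /andP[al0 alpi] := al_pi.
have [K K3 KE] := ex_period fM al_pi lamE.
have tK : t ^+ K = 1 by rewrite lamE turn_mxX // KE rot_mx_2pi.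
exists al, K; split=> //; apply/seteqP; split=> [F [TF F0]|_ [j _ <-]].
  have [N fN FE] := face_frame TF; rewrite FE in F0; have [i _ Ni] := F0.
  have [l il] : exists l, i != l by elim/ord3_ind: i {Ni}; [exists 1|exists 0|exists 0].
  have [u [fN' N'N N'0 _]] := frame_reorder fN il.
  have [j jE] := faces_at_vertex fM fN' (etrans N'0 Ni).
  exists (j %% K)%N; first by rewrite /= ltn_mod (leq_trans _ K3).
  by rewrite expr_mod // -jE N'N.
have [_ Tj] := frame_turn j fM; split=> //.
by exists 0 => //; exact: row0_turn.
Qed.

Lemma row_set_mulr (A C M : 'M[R]_3) : M \in unitmx ->
  row_set (A * M) = row_set (C * M) -> row_set A = row_set C.
Proof.
move=> Mu; have rows X : row_set X = (fun x => coord M x) @` row_set (X * M).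
  by apply/seteqP; split=> [_ [i _ <-]|_ [_ [i _ <-] <-]]; [exists (row i (X * M))|exists i];
    rewrite ?coord_mul_row //; exists i.
by move=> eqM; rewrite (rows A) (rows C) eqM.
Qed.

Lemma rot_row_cos (al a b : R) : 0 < al < pi ->
  row 1 (rot_mx al a) = row 1 (rot_mx al b) -> cos (a - b) = 1.
Proof.
move=> /andP[al0 alpi] /rowP rowE; have s0 := sin_al_gt0 al0 alpi.
have := rowE ord_max; have := rowE 1; rewrite !mxE /= => c s.
have sE : sin a = sin b by apply: (mulIf (invr_neq0 (lt0r_neq0 s0))).
have cE : cos a = cos b by move: c; rewrite s => /addIr.
by rewrite cosB sE cE -!expr2 cos2Dsin2.
Qed.

(** Rows 1 and 2 of [t ^+ l] point in the directions l and l + 1. As K is at least 3, these are the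
    directions 0 and 1 modulo K only if K divides l. *)
Lemma vertex_faces_inj M (al : R) K : frame M -> 0 < al < pi -> lam = 2 * cos al ->
  al *+ K = 2 * pi -> (3 <= K)%N ->
  {in `I_K &, injective (fun j => row_set (t ^+ j * M))}.
Proof.
move=> fM al_pi lamE KE K3; have /andP[al0 alpi] := al_pi; have [Mu _] := fM.
have row_neq i j : (i < j)%N -> (j - i < K)%N -> row 1 (t ^+ i) <> row 1 (t ^+ j).
  move=> ij jiK; rewrite lamE !turn_mxX // => /esym/(rot_row_cos al_pi).
  rewrite -mulrnBr ?(ltnW ij) // => c1.
  have : cos (al *+ (j - i)) < 1; last by rewrite c1 ltxx.
  apply: cos_lt1; rewrite -KE ltr_pMn2l // jiK andbT.
  by rewrite pmulrn_lgt0 // subn_gt0.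
have row_max j : row ord_max (t ^+ j) = row 1 (t ^+ j.+1).
  by rewrite exprS [RHS]mx3_row /= !scale0r scale1r !add0r.
have row0 j : row 0 (t ^+ j) = row 0 1.
  by rewrite -[t ^+ j]mulr1 row0_turn.
have row10 j : row 1 (t ^+ j) <> row 0 1.
  rewrite -(row0 j) => /(row_inj _)/eqP; rewrite unitrX ?turn_mx_unit //.
  by move/(_ isT).
have no_eq i j : (i < j < K)%N -> row_set (t ^+ i * M) <> row_set (t ^+ j * M).
  move=> /andP[ij jK] ijE; pose l := (j - i)%N.
  have tl : t ^+ j * M = t ^+ l * (t ^+ i * M) by rewrite mulrA -exprD subnK // ltnW.
  have l0 : (0 < l)%N by rewrite subn_gt0.
  have lK : (l < K)%N by rewrite (leq_ltn_trans (leq_subr _ _)).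
  have [fMi _] := frame_turn i fM.
  have {tl} : row_set 1 = row_set (t ^+ l).
    by apply: (row_set_mulr fMi); rewrite mul1r -tl.
  move=> sets; have rows x : row_set 1 x -> [\/ x = row 0 1, x = row 1 (t ^+ 0) | x = row 1 (t ^+ 1)].
    rewrite row_set3 -row_max expr0 => -[[->|->]|->]; [exact: Or31|exact: Or32|exact: Or33].
  have : row_set 1 (row 1 (t ^+ l)) by rewrite sets; exists 1.
  move=> /rows[/row10 //|/esym|/esym l1]; first by apply: row_neq; rewrite ?subn0.
  have lE : l = 1%N.
    apply/eqP; rewrite eqn_leq l0 andbT leqNgt; apply/negP => l2.
    by apply: row_neq l1 => //; rewrite (leq_ltn_trans (leq_subr _ _)).
  have : row_set 1 (row 1 (t ^+ 2)) by rewrite sets -row_max lE; exists ord_max.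
  move=> /rows[/row10 //|/esym|/esym]; apply: row_neq => //.
  by rewrite subSS subn0 (leq_trans _ K3).
move=> i j /set_mem iK /set_mem jK ijE; case: (ltngtP i j) => // [ij|ji].
  by case: (no_eq i j); rewrite ?ij.
by case: (no_eq j i); rewrite ?ji.
Qed.

(** One turn meets each face at the vertex exactly once, so the valency identifies [K] with [m]. *)
Lemma tessellation_angle M : frame M -> (3 <= m)%N /\ lam = 2 * cos (2 * pi / m%:R).
Proof.
move=> fM; have [al [K [al_pi lamE KE K3 facesE]]] := vertex_faces fM.
have inj := vertex_faces_inj fM al_pi lamE KE K3.
have v0 : vertices T (row 0 M) by have [_ TM] := fM; exists (row_set M) => //; exists 0.
have Km : K = m.
  apply/card_eq_II; have := tess_valency tess v0; rewrite facesE.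
  rewrite card_eq_sym => /card_eq_trans H; rewrite card_eq_sym; apply: H.
  by rewrite inj_card_eq.
split; first by rewrite -Km.
rewrite lamE -KE Km -(mulr_natr al) mulfK // pnatr_eq0 -Km.
by case: (K) K3.
Qed.

(** * Every face is reached from a given one *)

Section Connectedness.
Variable M0 : 'M[R]_3.
Hypothesis fM0 : frame M0.

Definition reachable (F : set V) := exists u, F = row_set (word_mx lam u * M0).

Lemma reachable_share F F' v : reachable F -> T F' -> F v -> F' v -> reachable F'.
Proof.
move=> [u ->] TF' [i _ iv] F'v; have fM := frame_word u fM0.
have [N fN FE] := face_frame TF'; rewrite FE in F'v *; have [j _ jv] := F'v.
have other (r : 'I_3) : exists l, r != l.
  by elim/ord3_ind: r; [exists 1|exists 0|exists 0].
have [[l il] [l' jl']] := (other i, other j).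
have [w [fM' M'M M'0 _]] := frame_reorder fM il.
have [w' [fN' N'N N'0 _]] := frame_reorder fN jl'.
have [p pE] := faces_at_vertex fM' fN' (etrans N'0 (etrans jv (etrans (esym iv) (esym M'0)))).
have [w'' tE] := turn_mx_word lam p.
by exists (w'' ++ w ++ u); rewrite -N'N pE tE !word_mx_cat !mulrA.
Qed.

Lemma reachable_point F F' x : reachable F -> T F' -> open_cone k x ->
  hull_cone F x -> hull_cone F' x -> reachable F'.
Proof.
move=> rF TF' ox hF hF'; have [u FE] := rF.
have fM := frame_word u fM0; have [Mu _] := fM.
have [N fN F'E] := face_frame TF'.
have /existsNP[i] : ~ forall i, coord (word_mx lam u * M0) x 0 i = 0.
  move=> x0; case: ox; rewrite (coordK x Mu) sum3 !x0 !scale0r !addr0.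
  by rewrite -(scale0r 0) surface_formZl mul0r ltxx.
move=> xi; have {xi} xi : 0 < coord (word_mx lam u * M0) x 0 i.
  rewrite lt_def; apply/andP; split; first exact/eqP.
  by move: hF; rewrite FE => /(hull_cone_coord _ Mu).
apply: (reachable_share rF TF' (v := row i (word_mx lam u * M0))).
  by rewrite FE; exists i.
by rewrite F'E; apply: (common_vertex fM fN ox) => //; rewrite -?FE -?F'E.
Qed.

Lemma segment_open_cone p q s : surface k p -> surface k q -> q != - p ->
  0 <= s <= 1 -> open_cone k (p + s *: (q - p)).
Proof.
move=> Sp Sq pq /andP[s0 s1].
have op := surface_open_cone Sp; have oq := surface_open_cone Sq.
have Bpp : B p p = 1 by case: Sp.
have Bqq : B q q = 1 by case: Sq.
have Bpq : -1 < B p q.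
  have [k1|k0] : k = 1 \/ k <= 0 by case: curv => ->; [left|right|right]; lra.
    have [+ _] : open_cone k (p + q).
      by apply: open_cone_sphere => //; rewrite addrC -[p]opprK subr_eq0.
    by rewrite !surface_formE Bpp Bqq (surface_formC _ q p); lra.
  by apply: lt_trans (surface_form_gt0 curv k0 op oq); rewrite ltrN10.
split.
  rewrite !surface_formE Bpp Bqq (surface_formC _ q p).
  set u := s * (1 - s); have u0 : 0 <= u by rewrite mulr_ge0 // subr_ge0.
  rewrite [X in 0 < X](_ : _ = (1 - 2 * s) ^+ 2 + 2 * u * (1 + B p q)); last by rewrite /u; ring.
  have [uE|un0] := eqVneq u 0.
    have -> : (1 - 2 * s) ^+ 2 = 1 - 4 * u by rewrite /u; ring.
    by rewrite uE; lra.
  have up : 0 < u by rewrite lt_def un0.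
  have Bp : 0 < 1 + B p q by lra.
  by apply: ltr_wpDl; [exact: sqr_ge0|do 2?apply: mulr_gt0].
move=> k0; rewrite !mxE; case: Sp => _ /(_ k0) p2; case: Sq => _ /(_ k0) q2.
have [sE|sn0] := eqVneq s 0; first by rewrite sE mul0r addr0.
have -> : p 0 2 + s * (q 0 2 - p 0 2) = (1 - s) * p 0 2 + s * q 0 2 by ring.
by rewrite ltr_wpDl ?mulr_gt0 ?mulr_ge0 ?subr_ge0 ?(ltW p2) // lt_def sn0.
Qed.

Lemma clopen_segment (P : R -> Prop) : P 0 ->
  (forall s, 0 <= s <= 1 -> P s -> \forall r \near s, 0 <= r <= 1 -> P r) ->
  (forall s, 0 <= s <= 1 -> ~ P s -> \forall r \near s, 0 <= r <= 1 -> ~ P r) ->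
  P 1.
Proof.
move=> P0 Popen Pclosed; pose A : set R := `[0, 1]%classic.
pose I Q : set R := [set s | \forall r \near s, 0 <= r <= 1 -> Q r].
have I_open Q : open (I Q) by exact: open_interior.
have AE s : A s <-> 0 <= s <= 1 by rewrite /A /= in_itv.
have IQ Q s : A s -> I Q s -> Q s by move=> /AE s01 /nbhs_singleton; exact.
have : [set s | A s /\ P s] = A.
  apply: (@segment_connected R 0 1).
  - by exists 0; split=> //; apply/AE; rewrite lexx ler01.
  - exists (I P) => //; apply/seteqP; split=> s [As Ps]; split=> //; last exact: IQ.
    by apply: Popen => //; apply/AE.
  - exists (~` I (fun r => ~ P r)); first exact: open_closedC.
    apply/seteqP; split=> s [As Ps]; split=> //; first by move=> /(IQ _ _ As).
    by apply: contrapT => nPs; apply: Ps; apply: Pclosed => //; apply/AE.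
move=> AP; suff : A 1 by rewrite -AP => -[].
by apply/AE; rewrite lexx ler01.
Qed.

(** Along a segment, lying in a reachable face is an open and closed condition: faces at nearby
    points contain the given point, and faces with a common point share a vertex. *)
Lemma all_reachable F : T F -> reachable F.
Proof.
move=> TF; have [N fN FE] := face_frame TF; have [Nu _] := fN.
pose p := row 0 M0; have Sp : surface k p by exact: frame_surface.
(* The end of the segment must not be opposite to [p], or the segment would pass through the
   origin. *)
have [i qn] : exists i, row i N != - p.
  have [r0|] := eqVneq (row 0 N) (- p); last by exists 0.
  by exists 1; rewrite -r0; apply/eqP => /(row_inj Nu)/eqP.
pose q := row i N; have Sq : surface k q by exact: frame_surface.
pose x s := p + s *: (q - p).
pose P s := exists F', [/\ reachable F', T F' & hull_cone F' (x s)].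
have row_hull M j : frame M -> hull_cone (row_set M) (row j M).
  by move=> [Mu _]; apply/hull_cone_coord => // l; rewrite coord_row // mxE.
have near_x (s : R) : 0 <= s <= 1 -> \forall r \near s, open_cone k (x r) /\
    forall F, T F -> hull_cone F (x r) -> hull_cone F (x s).
  move=> s01; have /nbhs_ballP[e e0 ball_e] :=
    near_face (q - p) (segment_open_cone Sp Sq qn s01).
  apply/nbhs_ballP; exists e => // r /= sr.
  have -> : x r = x s + (r - s) *: (q - p).
    by rewrite /x -addrA -scalerDl [s + _]addrC subrK.
  apply: ball_e; rewrite /ball /= sub0r normrN.
  by move: sr; rewrite /ball /= distrC.
have [F' [rF' TF' hF']] : P 1.
  apply: clopen_segment.
  - exists (row_set M0); split; first by exists [::]; rewrite word_mx_nil.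
      by case: fM0.
    by rewrite /x scale0r addr0; exact: row_hull.
  - move=> s s01 [F' [rF' TF' hF']]; have near_s := near_x s s01.
    near=> r => r01; have [oxr faces] : open_cone k (x r) /\
      forall F, T F -> hull_cone F (x r) -> hull_cone F (x s) by near: r.
    have [F1 TF1 hF1] := face_cover oxr; exists F1; split=> //.
    apply: (reachable_point rF' TF1 _ hF' (faces _ TF1 hF1)).
    exact: segment_open_cone.
  - move=> s s01 nPs; have near_s := near_x s s01.
    near=> r => r01 [F' [rF' TF' hF']]; apply: nPs; exists F'; split=> //.
    have [_ faces] : open_cone k (x r) /\
      forall F, T F -> hull_cone F (x r) -> hull_cone F (x s) by near: r.
    exact: faces.
apply: (reachable_point rF' TF (x := x 1)) => //.
  by apply: segment_open_cone => //; rewrite ler01 lexx.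
by rewrite FE /x scale1r addrC subrK; exact: row_hull.
Unshelve. all: by end_near. Qed.

Lemma vertex_reachable v : vertices T v -> exists u, row 0 (word_mx lam u * M0) = v.
Proof.
move=> [F TF Fv]; have [u FE] := all_reachable TF.
have fM := frame_word u fM0; rewrite FE in Fv; have [i _ iv] := Fv.
have [l il] : exists l, i != l by elim/ord3_ind: i {iv}; [exists 1|exists 0|exists 0].
have [w [_ _ M0' _]] := frame_reorder fM il.
by exists (w ++ u); rewrite word_mx_cat -mulrA M0'.
Qed.

End Connectedness.

(** * Rotations about vertices in terms of frames *)

Lemma rotationD (th : R) v x y : rotation k th v (x + y) = rotation k th v x + rotation k th v y.
Proof. by apply/rV3_eq; rewrite /rotation /surface_form !mxE /=; ring. Qed.

Lemma rotationZ (th r : R) v x : rotation k th v (r *: x) = r *: rotation k th v x.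
Proof. by apply/rV3_eq; rewrite /rotation /surface_form !mxE /=; ring. Qed.

(** The ratio g / (1 + g) of the two values is the cosine of the angle of a face, equal to lam /
    2. *)
Lemma frame_tangent_form M (i j : 'I_3) : frame M -> i != 0 -> j != 0 ->
  tangent_form k (row i M - g *: row 0 M) (row j M - g *: row 0 M) =
  if i == j then (1 + g) * (d / 2) else g * (d / 2).
Proof.
move=> fM i0 j0; have gE : g = 1 - k * d / 2 by [].
have [k0|kn0] := eqVneq k 0.
  have g1 : g = 1 by rewrite gE k0; lra.
  have tfE u v w : tangent_form k (u - w) (v - w) =
      (chord2 k u w + chord2 k v w - chord2 k u v) / 2.
    by rewrite /tangent_form /chord2 k0 !mxE; field.
  rewrite g1 scale1r tfE !(frame_chord2 (j := 0)) //; case: eqP => [->|/eqP ij].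
    by rewrite /chord2 !subrr expr0n /=; field.
  by rewrite frame_chord2 //; lra.
have k2 : k * k = 1 by case: curv kn0 => -> //; rewrite ?eqxx // => _; lra.
have tfE u v : tangent_form k u v = k * B u v.
  rewrite -[LHS]mul1r -k2 /tangent_form /surface_form -mulrA; congr (k * _).
  by rewrite mulrDr mulrA k2 mul1r.
rewrite tfE !surface_formE !frame_form1 // !(frame_form _ (j := 0)) //.
rewrite (surface_formC _ (row 0 M)) (frame_form _ (j := 0)) //.
have kE : k * (1 - g) = d / 2 by rewrite gE opprB addrC subrK !mulrA k2 mul1r.
case: eqP => [->|/eqP ij]; rewrite ?frame_form1 ?frame_form // -kE; ring.
Qed.

Lemma twisted_cross_sub v x (r : R) : twisted_cross k v (x - r *: v) = twisted_cross k v x.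
Proof. by apply/rV3_eq; rewrite !mxE /=; ring. Qed.

Lemma rotation_row1 M : frame M -> 0 < \det M ->
  rotation k (2 * pi / m%:R) (row 0 M) (row 1 M) = row ord_max M.
Proof.
move=> fM; rewrite det3E => D0; have [m3 lamE] := tessellation_angle fM.
have gb := gram_bound fM; have d0 := side_gt0 fM.
set th := 2 * pi / m%:R in lamE *.
have th0 : 0 < th by rewrite divr_gt0 ?mulr_gt0 ?pi_gt0 // ltr0n (leq_trans _ m3).
have thpi : th < pi.
  rewrite ltr_pdivrMr ?ltr0n ?(leq_trans _ m3) // mulrC ltr_pM2l ?pi_gt0 //.
  by rewrite (ltr_nat R 2).
have cosE : g = cos th * (1 + g).
  have -> : cos th = g / (1 + g).
    have -> : cos th = lam / 2 by rewrite lamE; field.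
    by rewrite /lam; field; rewrite gt_eqF //; lra.
  by rewrite divfK // gt_eqF //; lra.
rewrite /rotation frame_form // -(twisted_cross_sub _ (row 1 M) g) -addrA.
rewrite -(tangent_rotation (y := row ord_max M - g *: row 0 M) (h := (1 + g) * (d / 2)) curv) //.
- by rewrite addrC subrK.
- exact: frame_form1.
- by rewrite !surface_formE frame_form1 // frame_form //; lra.
- by rewrite !surface_formE frame_form1 // frame_form //; lra.
- by rewrite mulr_gt0 ?divr_gt0 //; lra.
- by rewrite frame_tangent_form.
- by rewrite frame_tangent_form.
- by rewrite frame_tangent_form //= {1}cosE -mulrA.
- by rewrite sin_gt0_pi // th0.
- by rewrite (_ : det3 _ _ _ = det3 (row 0 M) (row 1 M) (row ord_max M)) // /det3 !mxE; ring.
Qed.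

Lemma rotation_frame M x : frame M -> 0 < \det M ->
  rotation k (2 * pi / m%:R) (row 0 M) x = x *m (M^-1 * (t * M)).
Proof.
move=> fM D0; have [Mu _] := fM.
suff rowE i : rotation k (2 * pi / m%:R) (row 0 M) (row i M) = row i (t * M).
  rewrite {1}(coordK x Mu) sum3 !rotationD !rotationZ !rowE.
  by rewrite mulmxA -/(coord M x) mulmx_sum_row sum3.
have t1 : t * M = t ^+ 1 * M by [].
have tM0 : row 0 (t * M) = row 0 M by exact: (row0_turn lam 1).
have tM1 : row 1 (t * M) = row ord_max M by rewrite mx3_row /= !scale0r scale1r !add0r.
elim/ord3_ind: i.
- rewrite tM0 /rotation frame_form1 // scale1r subrr scaler0 addr0.
  rewrite (_ : twisted_cross _ _ _ = 0) ?scaler0 ?addr0 //.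
  by apply: rV3_eq; rewrite !mxE /=; ring.
- by rewrite rotation_row1.
(* Row 2 of [M] is row 1 of the next frame [t * M], which has the same orientation. *)
- rewrite -tM1 -tM0; apply: rotation_row1; first exact: (frame_turn 1).
  by rewrite det_mulmx det_turn_mx mul1r.
Qed.

End Tessellation.

(** * The central extension *)

(** Injectivity of the right translations does not pass to images, so it is assumed. *)
Lemma quandle_image (X Y : Type) (A : set X) (opX : X -> X -> X) (C : set Y)
    (opY : Y -> Y -> Y) (p : X -> Y) :
  is_quandle A opX -> quandle_epi A opX C opY p ->
  (forall y, C y -> set_inj C (fun w => opY w y)) -> is_quandle C opY.
Proof.
move=> [[x0 Ax0] clA idA bijA distA] [funp morp surp] injC.
split.
- by exists (p x0); exact: funp.
- move=> _ _ /surp[x Ax <-] /surp[y Ay <-]; rewrite -morp //.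
  exact/funp/clA.
- by move=> _ /surp[x Ax <-]; rewrite -morp // idA.
- move=> y Cy; split; last 1 first.
  + move: y Cy => _ /surp[y Ay <-] _ /surp[x Ax <-].
    have [_ _ /(_ x Ax)[w Aw <-]] := bijA y Ay.
    by exists (p w); [exact: funp|rewrite morp].
  + move: y Cy => _ /surp[y Ay <-] _ /surp[x Ax <-] /=; rewrite -morp //.
    exact/funp/clA.
  + exact: injC.
- move=> _ _ _ /surp[x Ax <-] /surp[y Ay <-] /surp[w Aw <-].
  have [Axy Axw Ayw] : [/\ A (opX x y), A (opX x w) & A (opX y w)].
    by split; exact: clA.
  by rewrite -!morp // (distA x y w).
Qed.

Lemma knot_quandle n : is_quandle [set: fiber_group n.+1] (@knot_quandle_op n.+1).
Proof.
have [phi' phiK phi'K] := monodromy_bij n.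
split=> //.
- by exists 1%g.
- by move=> x _; rewrite /knot_quandle_op mulgV monodromy1 mul1g.
- move=> x _; split=> //.
    by move=> w w' _ _ /mulIg/(can_inj phiK)/mulIg.
  move=> w _; exists (phi' (w * x^-1) * x)%g => //.
  by rewrite /knot_quandle_op mulgK phi'K mulgVK.
- move=> x y w _ _ _; rewrite /knot_quandle_op [RHS]mulgA; congr (_ * w)%g.
  have -> : (monodromy (x * w^-1) * w * (monodromy (y * w^-1) * w)^-1)%g =
      monodromy (x * y^-1)%g.
    rewrite invgM mulgA mulgK -monodromyV -monodromyM; congr monodromy.
    by rewrite invgM invgK mulgA mulgVK.
  by rewrite -monodromyM mulgA.
Qed.

Section CentralExtension.
Variables (R : realType) (n : nat) (T : set (set 'rV[R]_3)) (M : 'M[R]_3).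
Local Notation m := n.+1.
Local Notation G := (fiber_group m).
Local Notation z := (fiber_center n).
Hypothesis m_ge3 : (3 <= m)%N.
Hypotheses (fM : frame T M) (det_gt0 : 0 < \det M).
Let lam : R := 2 * cos (2 * pi / m%:R).
Local Notation t := (turn_mx lam).
Hypothesis frame_words : forall u, frame T (word_mx lam u * M).
Hypothesis vertex_words : forall v, vertices T v ->
  exists u, row 0 (word_mx lam u * M) = v.
Hypothesis rotation_words : forall N v, frame T N -> 0 < \det N ->
  vertex_rotation m (row 0 N) v = v *m (N^-1 * (t * N)).

(** Isometries multiply row vectors on the right, so this is the image of v under the inverse of
    x. *)
Definition vertex_of (x : G) : 'rV[R]_3 := row 0 (trefoil_rep lam x * M).

Definition schlafli_proj (x : G) := (vertex_of x, vertex_rotation m (vertex_of x)).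

Let t_order : t ^+ m = 1 := turn_mx_order R m_ge3.

Lemma frame_rep (x : G) : frame T (trefoil_rep lam x * M).
Proof. by have [u <- _] := word_mx_reach t_order x; exact: frame_words. Qed.

(** All frames [trefoil_rep lam x * M] are positively oriented, as the formula for rotations
    requires. *)
Lemma det_trefoil_rep (x : G) : \det (trefoil_rep lam x) = 1.
Proof.
have dt k : \det (t ^+ k) = 1.
  elim: k => [|k IHk]; first by rewrite expr0 det1.
  by rewrite exprS det_mulmx IHk det_turn_mx mulr1.
have dtV k : \det (t ^- k) = 1 by rewrite det_inv dt invr1.
have dh : \det (half_turn_mx lam) = 1 by rewrite det3E /det3 !mxE /=; ring.
have dgen k : \det (trefoil_rep lam (@fiber_gen m k)) = 1.
  by rewrite (trefoil_rep_gen t_order) !det_mulmx !dtV dt dh !mulr1.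
elim/fiber_group_ind: x => [|k x IHx|k x IHx].
- by rewrite trefoil_rep1 // det1.
- by rewrite trefoil_repM // det_mulmx dgen IHx mulr1.
- by rewrite trefoil_repM // det_mulmx trefoil_repV // det_inv dgen IHx invr1 mulr1.
Qed.

Lemma vertices_vertex_of x : vertices T (vertex_of x).
Proof. by have [_ TF] := frame_rep x; exists (row_set (trefoil_rep lam x * M)) => //; exists 0. Qed.

Lemma vertex_of_surj v : vertices T v -> exists x, vertex_of x = v.
Proof.
move=> /vertex_words[u <-]; exists (flag_act u (1%g : G, ord0, true)).1.1.
by rewrite /vertex_of !row_mul -row0_word_mx.
Qed.

Lemma rotation_vertex_of x v : vertex_rotation m (vertex_of x) v =
  v *m ((trefoil_rep lam x * M)^-1 * (t * (trefoil_rep lam x * M))).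
Proof.
rewrite rotation_words //; first exact: frame_rep.
by rewrite det_mulmx det_trefoil_rep mul1r.
Qed.

Lemma row0_turnV j : row 0 (t ^- j) = row 0 1.
Proof.
have tj : row 0 (t ^+ j) = row 0 1.
  by rewrite -[t ^+ j]mulr1 row0_turn.
rewrite -[t ^- j]mul1r [LHS]row_mul -tj -row_mul [_ *m _]divrr // unitrX //.
exact: turn_mx_unit.
Qed.

Lemma vertex_of_op x y :
  vertex_of (knot_quandle_op x y) = vertex_rotation m (vertex_of y) (vertex_of x).
Proof.
rewrite rotation_vertex_of /vertex_of /knot_quandle_op.
rewrite trefoil_repM // trefoil_rep_monodromy // trefoil_repM // trefoil_repV //.
have [Mu _] := fM; have yu := trefoil_rep_unit t_order y.
have xu := trefoil_rep_unit t_order x.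
rewrite -row_mul invrM // -!mulrA -[_ *m _]/(_ * _).
(* The leading [t^-1] coming from the monodromy preserves row 0, and the remaining product is the
   rotation about the vertex of [y]. *)
rewrite row_mul (row0_turnV 1) -row_mul mul1mx; congr row.
by rewrite -!mulrA mulVKr.
Qed.

Lemma vertex_of_eq x y : vertex_of x = vertex_of y -> in_cycle z (x * y^-1)%g.
Proof.
have [Mu _] := fM; rewrite /vertex_of !row_mul => /(can_inj (mulmxK Mu)) xy.
apply: (trefoil_rep_vertex (R := R)) => //.
by rewrite trefoil_repM // trefoil_repV // row_mul xy -row_mul [_ *m _]divrr //
  trefoil_rep_unit.
Qed.

Lemma vertex_of_cycle c x : in_cycle z c -> vertex_of (c * x)%g = vertex_of x.
Proof.
have rowz i y : row 0 (trefoil_rep lam (z ^+ i * y)%g) = row 0 (trefoil_rep lam y).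
  elim: i => [|i IHi]; first by rewrite expg0 mul1g.
  rewrite expgS -mulgA trefoil_repM // trefoil_rep_center // row_mul row0_turnV.
  by rewrite -row_mul mul1mx.
have rowM (X Y Z : 'M[R]_3) : row 0 X = row 0 Y -> row 0 (X * Z) = row 0 (Y * Z).
  by move=> XY; rewrite !row_mul XY.
move=> /in_cycleP[i [j cE]]; apply: rowM.
by rewrite -(rowz i) mulgA cE rowz.
Qed.

Lemma monodromy_cycle c : in_cycle z c -> monodromy c = c.
Proof.
have phiX i : monodromy (z ^+ i)%g = (z ^+ i)%g.
  elim: i => [|i IHi]; first by rewrite expg0 monodromy1.
  by rewrite expgS monodromyM IHi monodromy_center.
move=> /in_cycleP[i [j cE]]; apply: (mulgI (z ^+ i)%g).
by rewrite -{1}(phiX i) -monodromyM cE phiX.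
Qed.

Lemma schlafli_proj_epi : quandle_epi [set: G] (@knot_quandle_op m)
  (schlafli_set m T) (@schlafli_op R m) schlafli_proj.
Proof.
split.
- by move=> x _; exists (vertex_of x) => //; exact: vertices_vertex_of.
- by move=> x y _ _; rewrite /schlafli_proj /schlafli_op /= vertex_of_op.
- by move=> _ [v Tv <-]; have [x <-] := vertex_of_surj Tv; exists x.
Qed.

Lemma schlafli_proj_eq x y : schlafli_proj x = schlafli_proj y <->
  in_cycle z (x * y^-1)%g.
Proof.
split=> [[/vertex_of_eq//]|cxy].
by rewrite /schlafli_proj -[x](mulgVK y) vertex_of_cycle.
Qed.

Lemma knot_quandle_central_extension :
  central_extension [set: G] (@knot_quandle_op m) (schlafli_set m T) (@schlafli_op R m).
Proof.
have epi := schlafli_proj_epi.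
split.
- exact: knot_quandle.
- apply: quandle_image (knot_quandle n) epi _ => _ [v Tv <-].
  have [y <-] := vertex_of_surj Tv; move=> _ _ /set_mem[v1 Tv1 <-] /set_mem[v2 Tv2 <-].
  rewrite /schlafli_op /= !rotation_vertex_of => -[+ _].
  have [Nu _] := frame_rep y.
  have Xu : (trefoil_rep lam y * M)^-1 * (t * (trefoil_rep lam y * M)) \in unitmx.
    by rewrite !unitmx_mul (turn_mx_unit lam) unitmx_inv -unitmx_mul Nu.
  by move/(can_inj (mulmxK Xu)) => ->.
exists (cycle_type z), (fun c x => val c * x)%g, schlafli_proj.
have cycleP (c : cycle_type z) : in_cycle z (val c) by exact: (proj2_sig c).
have comm_op (c : cycle_type z) x y :
    knot_quandle_op (val c * x)%g y = (val c * knot_quandle_op x y)%g.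
  rewrite /knot_quandle_op -(mulgA (val c) x) (monodromyM (val c)).
  by rewrite (monodromy_cycle (cycleP c)) -mulgA.
have op_fiber (c : cycle_type z) x y :
    knot_quandle_op x (val c * y)%g = knot_quandle_op x y.
  rewrite /knot_quandle_op invgM (mulgA x) (monodromyM (x * y^-1)%g) monodromyV.
  by rewrite (monodromy_cycle (cycleP c)) mulgA mulgVK.
pose elt x (cx : in_cycle z x) : cycle_type z := exist _ x cx.
split=> //.
- exists (elt z (in_cycleX z 1)); apply/eqP => /(congr1 val) /= z1.
  by have := fiber_center_neq1 R m_ge3; rewrite z1 eqxx.
- by split=> // [x _|a b x _]; rewrite /= ?mul1g ?mulgA.
- move=> w x y _ _ _ /schlafli_proj_eq cxy.
  by rewrite -[x](mulgVK y) (op_fiber (elt _ cxy)).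
- by move=> a x _; apply/schlafli_proj_eq; rewrite mulgK; exact: cycleP.
- move=> a x _ /(canRL (mulgK x)); rewrite mulgV => a1; exact/val_inj.
- move=> x y _ _ /esym/schlafli_proj_eq cyx; exists (elt _ cyx) => /=.
  by rewrite mulgVK.
Qed.

End CentralExtension.

Theorem theorem6p3 (R : realType) (m : nat) (T : set (set 'rV[R]_3))
  (m_ge3 : (3 <= m)%N) (T_3m : is_tessellation_3m m T) :
  central_extension [set: fiber_group m]%classic (@knot_quandle_op m)
    (schlafli_set m T) (@schlafli_op R m).
Proof.
case: m m_ge3 T_3m => // n m_ge3 tess.
have curv : [\/ curvature R n.+1 = 1, curvature R n.+1 = 0 | curvature R n.+1 = -1].
  by rewrite /curvature; case: ifP => _; [exact: Or31|case: ifP => _; [exact: Or32|exact: Or33]].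
have [d equil] := tess_equilateral tess.
have [M fM det_gt0] : exists2 M, frame T M & 0 < \det M.
  pose e : 'rV[R]_3 := delta_mx 0 2.
  have Se : surface (curvature R n.+1) e.
    by split=> [|_]; rewrite /surface_form !mxE /= ?mulr0n ?mulr1n; lra.
  have [F TF _] := tess_cover tess Se; have [M fM _] := face_frame equil TF.
  have [Mu _] := fM; have := Mu; rewrite unitmxE unitfE => Dn0.
  have [D0|D0] := ltP 0 (\det M); first by exists M.
  (* Exchanging two vertices reverses the orientation. The reflection 0 is the same for every [lam],
     so the parameter 0 is a placeholder. *)
  exists (simple_mx 0 ord0 * M); first exact: frame_simple0.
  rewrite det_mulmx (_ : \det (simple_mx 0 ord0) = -1).
    by rewrite mulN1r oppr_gt0 lt_neqAle Dn0.
  by rewrite det3E /det3 !mxE /=; ring.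
have [_ lamE] := tessellation_angle curv tess equil fM.
apply: (knot_quandle_central_extension (M := M)) => //; rewrite -lamE.
- by move=> u; exact: (frame_word curv tess equil u fM).
- by move=> v; exact: (vertex_reachable curv tess equil fM).
- by move=> N v fN DN; exact: (rotation_frame curv tess equil).
Qed.
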